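(* Let $K$ be a number field of degree $n$ and $g \geq 2$. Assume the Hardy–Littlewood prime $k$-tuples conjecture for $K$. Then $c_K(g) \leq 2g - 1 + n\,\pi(2g)$.
   Context: $\pi(x)$ is the number of rational primes $\le x$. $c_K(g)$ is the smallest integer $m$ such that there exist infinitely many $\overline{K}$-isomorphism classes of genus $g$ hyperelliptic curves $C/K$ with all Weierstrass points in $K$ having potentially good reduction outside some set of $m$ primes of $K$. A $k$-tuple $(h_1,\dots,h_k)$ of distinct elements of $\mathcal{O}_K$ is admissible if for every prime $\mathfrak{p}$ of $K$ the set $\{h_1,\dots,h_k\}$ does not contain all residues mod $\mathfrak{p}$. An element $x\in\mathcal{O}_K$ is called prime if the principal ideal $(x)$ is prime. The Hardy–Littlewood prime $k$-tuples conjecture for $K$ asserts: for every $k$ and every admissible $k$-tuple $(h_1,\dots,h_k)$ in $\mathcal{O}_K$, there exist infinitely many $x \in \mathcal{O}_K$ such that each of $x+h_1,\dots,x+h_k$ is prime. *)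

(* Defs.v *)
From HB Require Import structures.
From mathcomp Require Import all_boot all_order all_algebra all_field.
From mathcomp Require Import boolp classical_sets functions cardinality.

Set Implicit Arguments.
Unset Strict Implicit.
Unset Printing Implicit Defensive.

Import GRing.Theory.
Local Open Scope classical_set_scope.
Local Open Scope card_scope.
Local Open Scope ring_scope.

(* Rings of integers are kept as subsets of the ambient field; the definitions
   make sense for every field and are used for number fields, presented either
   as [fieldExtType rat] or as finite extensions of such a field. *)
Definition integers (K : fieldType) : set K :=
  [set x | integralOver (intr : int -> K) x].

(* "Primes of K": the nonzero prime ideals of the ring of integers. *)
Record is_prime (K : fieldType) (p : set K) : Prop := IsPrime {
  prime_sub : p `<=` integers (K := K);
  prime_add : forall x y, p x -> p y -> p (x + y);
  prime_mull : forall a x, integers a -> p x -> p (a * x);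
  prime_neq0 : exists2 x, p x & x != 0;
  prime_proper : ~ p 1;
  prime_mul : forall x y, integers x -> integers y ->
    p (x * y) -> p x \/ p y }.

Definition principal (K : fieldType) (x : K) : set K :=
  (fun a => a * x) @` integers (K := K).

(* Nonzero prime elements; counting 0 as prime would change the conjecture
   below by at most k values of x for each k-tuple. *)
Definition prime_element (K : fieldType) (x : K) : Prop :=
  integers x /\ is_prime (principal x).

Definition admissible (K : fieldType) (k : nat) (h : k.-tuple K) : Prop :=
  [/\ uniq h, forall i, integers (tnth h i) &
      forall p, is_prime p ->
        exists2 r, integers r & forall i, ~ p (tnth h i - r)].

Definition hardy_littlewood (K : fieldType) : Prop :=
  forall (k : nat) (h : k.-tuple K), admissible h ->
    infinite_set
      [set x : K | integers x /\ forall i, prime_element (x + tnth h i)].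

Definition prime_pi (m : nat) : nat := #|[set p : 'I_m.+1 | prime p]|%SET.

(* The Weierstrass equation y^2 + wQ(x) y = wP(x). *)
Record weierstrass (R : nzRingType) := Weierstrass {
  wQ : {poly R};
  wP : {poly R} }.

Definition map_weierstrass (R S : nzRingType) (f : R -> S)
    (E : weierstrass R) : weierstrass S :=
  Weierstrass (map_poly f (wQ E)) (map_poly f (wP E)).

(* For genus g, the curve attached to E is glued from the affine curve E and
   the affine curve [chart_infty g E], along z = 1/x, w = y/x^(g+1). *)
Definition weierstrass_bounded (R : nzRingType) (g : nat)
    (E : weierstrass R) : Prop :=
  (size (wQ E) <= g.+2)%N /\ (size (wP E) <= (2 * g).+3)%N.

Definition chart_infty (R : nzRingType) (g : nat) (E : weierstrass R) :
    weierstrass R :=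
  Weierstrass (\poly_(i < g.+2) (wQ E)`_(g.+1 - i))
              (\poly_(i < (2 * g).+3) (wP E)`_((2 * g).+2 - i)).

Definition on_curve (R : nzRingType) (E : weierstrass R) (x y : R) : Prop :=
  y ^+ 2 + (wQ E).[x] * y = (wP E).[x].

Definition singular_at (R : nzRingType) (E : weierstrass R) (x y : R) : Prop :=
  y *+ 2 + (wQ E).[x] = 0 /\ (wQ E)^`().[x] * y = (wP E)^`().[x].

Definition smooth_chart (k : closedFieldType) (E : weierstrass k) : Prop :=
  forall x y, on_curve E x y -> ~ singular_at E x y.

Definition smooth (k : closedFieldType) (g : nat) (E : weierstrass k) : Prop :=
  smooth_chart E /\ smooth_chart (chart_infty g E).

Definition geom_smooth (F : fieldType) (g : nat) (E : weierstrass F) : Prop :=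
  forall (k : closedFieldType) (f : {rmorphism F -> k}),
    smooth g (map_weierstrass f E).

(* The hyperelliptic curves of genus g over F (for g >= 2) whose quotient by
   the hyperelliptic involution is P^1, which is automatic in the presence of
   a rational point; smoothness in both charts forces the genus to be g and
   the curve to be geometrically irreducible. *)
Definition hyperelliptic (F : fieldType) (g : nat) (E : weierstrass F) : Prop :=
  weierstrass_bounded g E /\ geom_smooth g E.

(* F(C) = F(x)[Y] / (Y^2 + wQ(x) Y - wP(x)). *)
Definition function_field_poly (F : fieldType) (E : weierstrass F) :
    {poly {fraction {poly F}}} :=
  'X^2 + (tofrac (wQ E))%:P * 'X - (tofrac (wP E))%:P.

Definition function_field (F : fieldType) (E : weierstrass F) :=
  {poly %/ function_field_poly E}.

Definition ff_const (F : fieldType) (E : weierstrass F) (c : F) :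
    function_field E :=
  qpolyC (function_field_poly E) (tofrac c%:P).

(* Isomorphism of smooth projective curves over F, as an F-isomorphism of
   their function fields. *)
Definition isomorphic (F : fieldType) (C D : weierstrass F) : Prop :=
  exists2 phi : {rmorphism function_field C -> function_field D},
    bijective phi & forall c, phi (ff_const C c) = ff_const D c.

(* An algebraic closure of a number field K is algC through an embedding of K;
   two embeddings differ by an automorphism of algC, so the choice of iota is
   immaterial. *)
Definition geom_isomorphic (K : fieldExtType rat) (C D : weierstrass K) : Prop :=
  exists iota : {rmorphism K -> algC},
    isomorphic (map_weierstrass iota C) (map_weierstrass iota D).

(* In characteristic 0 the Weierstrass points are the fixed points of the
   hyperelliptic involution (x, y) |-> (x, - y - wQ(x)). *)
Definition weierstrass_point (R : nzRingType) (E : weierstrass R) (x y : R) :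
    Prop :=
  on_curve E x y /\ y = - y - (wQ E).[x].

Definition rational_weierstrass_chart (K : fieldExtType rat)
    (E : weierstrass K) : Prop :=
  forall (iota : {rmorphism K -> algC}) (x y : algC),
    weierstrass_point (map_weierstrass iota E) x y ->
    exists x0 y0 : K, x = iota x0 /\ y = iota y0.

Definition rational_weierstrass (K : fieldExtType rat) (g : nat)
    (E : weierstrass K) : Prop :=
  rational_weierstrass_chart E /\ rational_weierstrass_chart (chart_infty g E).

(* The local ring of the ring of integers at p, and its maximal ideal. *)
Definition local_ring (L : fieldType) (p : set L) : set L :=
  [set x | exists a b,
     [/\ integers a, integers b, ~ p b & x = a / b]].

Definition local_max (L : fieldType) (p : set L) : set L :=
  [set x | exists a b,
     [/\ p a, integers b, ~ p b & x = a / b]].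

(* rho restricts to a ring morphism from the local ring at p with kernel its
   maximal ideal, i.e. it is an embedding of the residue field of p into k;
   the values of rho outside the local ring are irrelevant. *)
Record reduction (L k : fieldType) (p : set L) (rho : L -> k) : Prop :=
  Reduction {
    reduction1 : rho 1 = 1;
    reductionD : forall x y, local_ring p x -> local_ring p y ->
      rho (x + y) = rho x + rho y;
    reductionM : forall x y, local_ring p x -> local_ring p y ->
      rho (x * y) = rho x * rho y;
    reduction_eq0 : forall x, local_ring p x ->
      (rho x = 0 <-> local_max p x) }.

Definition integral_weierstrass (L : fieldType) (p : set L)
    (E : weierstrass L) : Prop :=
  forall i, local_ring p (wQ E)`_i /\ local_ring p (wP E)`_i.

(* C has a smooth projective Weierstrass model over the local ring at p: its
   generic fibre is isomorphic to C and its geometric special fibres are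
   smooth. *)
Definition good_reduction (L : fieldType) (g : nat) (p : set L)
    (C : weierstrass L) : Prop :=
  exists M : weierstrass L,
    [/\ isomorphic M C, weierstrass_bounded g M, integral_weierstrass p M &
        forall (k : closedFieldType) (rho : L -> k), reduction p rho ->
          smooth g (map_weierstrass rho M)].

Definition above (K : fieldType) (L : fieldExtType K) (P : set L) (p : set K) :
    Prop :=
  forall x : K, p x <-> P x%:A.

Definition potentially_good_reduction (K : fieldExtType rat) (g : nat)
    (p : set K) (C : weierstrass K) : Prop :=
  exists L : fieldExtType K, forall P : set L, is_prime P -> above P p ->
    good_reduction g P (map_weierstrass (in_alg L) C).

Definition potentially_good_outside (K : fieldExtType rat) (g : nat)
    (S : set (set K)) (C : weierstrass K) : Prop :=
  forall p, is_prime p -> ~ S p -> potentially_good_reduction g p C.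

Definition good_curve (K : fieldExtType rat) (g m : nat) (C : weierstrass K) :
    Prop :=
  [/\ hyperelliptic g C, rational_weierstrass g C &
      exists S : set (set K),
        [/\ S `<=` is_prime (K := K), S #= `I_m &
            potentially_good_outside g S C]].

Definition geom_class (K : fieldExtType rat) (g : nat) (C : weierstrass K) :
    set (weierstrass K) :=
  [set D | hyperelliptic g D /\ geom_isomorphic C D].

Definition infinitely_many_good (K : fieldExtType rat) (g m : nat) : Prop :=
  infinite_set (geom_class g @` good_curve (K := K) g m).

(* c = c_K(g). *)
Definition is_cK (K : fieldExtType rat) (g c : nat) : Prop :=
  infinitely_many_good K g c /\
  forall m, infinitely_many_good K g m -> (c <= m)%N.

(* Main.v *)
Require Import Defs.
From HB Require Import structures.
From mathcomp Require Import all_boot all_order all_algebra all_field.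
From mathcomp Require Import boolp classical_sets functions cardinality.
From mathcomp Require Import ring zify.

(** Put N = (2g)!.  For the tuple of the multiples dN with |d| < g, the
conjecture gives infinitely many x such that all the x + dN are prime, and one
considers the curve
  y^2 = X (X - x) (X + x) prod_(0 < i < g) (X - iN) (X + iN).
Up to sign, the difference of two roots is 2x, or some x + dN, or a divisor of
N^2, so the curve has good reduction outside the 2g - 1 primes (x + dN) and the
primes above the rational primes p <= 2g, of which there are at most n for each p.

It remains to see that finitely many x give the same geometric class.  Let phi be
an isomorphism from F(x, y) to F(t, s), with y^2 = f(x) and s^2 = h(t).  As t is
quadratic over F(phi x), Gauss's lemma makes phi x a root of a polynomial of
degree at most 2 over F[t], with coefficients of degree at most 2.  If phi x were not
in F(t), then h would agree up to squares with the discriminant of this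
polynomial, of degree at most 4, while h has at least 5 simple roots.  So phi x is
a rational function of t, then a Moebius transformation, which maps branch
points to branch points; hence x / N is one of the finitely many cross-ratios
of the branch points of the second curve. *)

Set Implicit Arguments.
Unset Strict Implicit.
Unset Printing Implicit Defensive.

Import GRing.Theory Num.Theory.
Local Open Scope ring_scope.

(** * Primes of the ring of integers *)

Section IntegralElements.
Variable K : fieldType.
Implicit Types (x y : K) (P Q : set K).

Lemma integers_int (m : int) : integers (m%:~R : K).
Proof. exact: integral_id. Qed.

Lemma integersB x y : integers x -> integers y -> integers (x - y).
Proof. exact: integral_sub. Qed.

Lemma integersM x y : integers x -> integers y -> integers (x * y).
Proof. exact: integral_mul. Qed.

Lemma integersN x : integers x -> integers (- x).
Proof. exact: integral_opp. Qed.

Lemma integers_nat n : integers (n%:R : K).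
Proof. exact: integral_nat. Qed.

Lemma integers_horner (p : {poly int}) x :
  integers x -> integers (map_poly intr p).[x].
Proof.
move=> ix; apply: integral_horner => // _ /(nthP 0)[i _ <-].
by rewrite coef_map; apply: integers_int.
Qed.

Lemma prime0 P : is_prime P -> P 0.
Proof.
by move=> pP; case: (prime_neq0 pP) => a Pa _; rewrite -(mul0r a);
  apply: (prime_mull pP) => //; apply: integers_nat 0%N.
Qed.

Lemma primeN P x : is_prime P -> P x -> P (- x).
Proof.
by move=> pP Px; rewrite -mulN1r; apply: (prime_mull pP) => //;
  apply: integersN; apply: integers_nat 1%N.
Qed.

Lemma primeB P x y : is_prime P -> P x -> P y -> P (x - y).
Proof. by move=> pP Px Py; apply: (prime_add pP) => //; apply: primeN. Qed.

Lemma prime_mulz P (m : int) x : is_prime P -> P x -> P (m%:~R * x).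
Proof. by move=> pP; apply: (prime_mull pP); apply: integers_int. Qed.

(** If [q] did not divide [m], a Bezout relation between them would put 1 in [P]. So the integers in
    [P] are exactly the multiples of [q]. *)
Lemma prime_int_dvd P (q : nat) (m : int) :
  is_prime P -> prime q -> P q%:R -> P m%:~R -> exists k, m = k * q%:Z.
Proof.
move=> pP q_pr Pq Pm; apply/dvdzP; rewrite -[(_ %| _)%Z]negbK.
apply/negP => ndv; apply: (prime_proper pP).
have /coprimezP[[u v] /= uv1]: coprimez q%:Z m.
  by rewrite coprimezE /= prime_coprime.
rewrite -[1]/((1 : int)%:~R) -uv1 rmorphD !rmorphM /=.
by apply: (prime_add pP); apply: prime_mulz.
Qed.

Lemma integers_monic x : integers x ->
  exists2 f : {poly int}, f \is monic & (map_poly intr f).[x] = 0.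
Proof. by case=> f mf /rootP; exists f. Qed.

(** Horner's scheme for monic polynomials: the quotient by X stays monic down to 1, so an integral
    equation can be shortened by removing its constant term. *)
Lemma monic_ind (T : {poly int} -> Prop) :
    T 1 -> (forall h c, h \is monic -> T h -> T (h * 'X + c%:P)) ->
  forall f, f \is monic -> T f.
Proof.
move=> T1 TS; elim/poly_ind => [|h c IH] mf.
  by move: mf; rewrite monicE lead_coef0 eq_sym oner_eq0.
have [h0|h0] := eqVneq h 0.
  move: mf; rewrite h0 mul0r add0r monicE lead_coefC => /eqP ->.
  exact: T1.
have mh: h \is monic.
  move: mf; rewrite !monicE lead_coefE size_MXaddC (negPf h0) /=.
  by rewrite coefD coefMX coefC size_poly_eq0 (negPf h0) addr0 -lead_coefE.
by apply: TS => //; apply: IH.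
Qed.

(** In a monic equation of a nonzero [a] in [P], a zero constant term allows division by [a]; a
    nonzero one is a multiple of [a], hence in [P]. *)
Lemma prime_has_int P : is_prime P -> exists2 c : int, c != 0 & P c%:~R.
Proof.
move=> pP; have [a Pa a0] := prime_neq0 pP.
have ia := prime_sub pP Pa; have [f mf fa] := integers_monic ia.
elim/monic_ind: f / mf fa => [|h c mh IH].
  by rewrite rmorph1 hornerC => /eqP; rewrite oner_eq0.
rewrite rmorphD rmorphM /= map_polyX map_polyC hornerMXaddC => e.
have [c0|c0] := eqVneq c 0.
  apply: IH; move/eqP: e; rewrite c0 addr0 mulf_eq0 (negPf a0) orbF.
  by move/eqP.
exists c => //; have /eqP := e; rewrite addrC addr_eq0 => /eqP ->.
by apply: primeN => //; apply: (prime_mull pP) => //; apply: integers_horner.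
Qed.

(** Split off the least prime factor; either it lies in [P] or the smaller cofactor does. The bound
    on [q] is used for the factors of a factorial. *)
Lemma natz_prime_factor P n : is_prime P -> P n.+1%:R ->
  exists q, [/\ prime q, (q <= n.+1)%N & P q%:R].
Proof.
move=> pP; have [m] := ubnP n; elim: m n => // m IH n ltm Pn.
case: n ltm Pn => [|n] ltm Pn; first by case: (prime_proper pP).
have q_pr := pdiv_prime (isT : (1 < n.+2)%N).
have /dvdnP[k ek] := pdiv_dvd n.+2; set q := pdiv n.+2 in q_pr ek.
have q1 := prime_gt1 q_pr.
move: Pn; rewrite ek natrM => /(prime_mul pP (integers_nat _) (integers_nat _)).
case=> [Pk|Pq]; last by exists q; split=> //; rewrite -ek pdiv_leq.
case: k ek Pk => // k ek Pk.
have ltk: (k.+1 < n.+2)%N by rewrite ek; nia.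
have [||q' [pr' le' Pq']] := IH k => //; first by lia.
by exists q'; split=> //; apply: leq_trans le' _; rewrite -ek ltnW.
Qed.

Lemma prime_has_prime P : is_prime P -> exists2 q, prime q & P q%:R.
Proof.
move=> pP; have [c c0 Pc] := prime_has_int pP.
have: P `|c|%N.+1.-1%:R.
  case: c c0 Pc => c c0 //= Pc.
  by rewrite -[_%:R]opprK; apply: primeN; rewrite // -mulrNz -NegzE.
case: c c0 {Pc} => [[|n]|n] // _ /(natz_prime_factor pP)[q [q_pr _ Pq]];
by exists q.
Qed.

(* Nonzero primes are incomparable.  If a monic f has f(a) in P for some a in
   Q, then its constant term lies in the intersection of Q with the integers,
   which is that of P, and can be dropped. *)
Lemma prime_incomparable P Q : is_prime P -> is_prime Q ->
  (P `<=` Q)%classic -> (Q `<=` P)%classic.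
Proof.
move=> pP pQ PQ a Qa; have [q q_pr Pq] := prime_has_prime pP.
have ia := prime_sub pQ Qa; have [f mf fa] := integers_monic ia.
have: P (map_poly intr f).[a] by rewrite fa; apply: prime0.
elim/monic_ind: f / mf {fa} => [|h c mh IH].
  by rewrite rmorph1 hornerC => /(prime_proper pP).
rewrite rmorphD rmorphM /= map_polyX map_polyC hornerMXaddC => Pf.
have ih := integers_horner h ia.
have Pc: P c%:~R.
  have Qc: Q c%:~R.
    rewrite -[_%:~R](addKr ((map_poly intr h).[a] * a)) addrC.
    by apply: primeB => //; [apply: PQ | apply: (prime_mull pQ)].
  have [k ->] := prime_int_dvd pQ q_pr (PQ _ Pq) Qc.
  by rewrite rmorphM; apply: prime_mulz.
have: P ((map_poly intr h).[a] * a) by rewrite -[_ * _](addrK c%:~R); apply: primeB.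
by move=> /(prime_mul pP ih ia)[/IH|].
Qed.

End IntegralElements.

(** * Bounding the number of primes above a rational prime *)

Section PrimesAboveRational.
Variable K : fieldExtType rat.

Lemma numfield_natr_eq0 n : (n%:R == 0 :> K) = (n == 0)%N.
Proof. by rewrite -(rmorph_nat (in_alg K)) fmorph_eq0 pnatr_eq0. Qed.

Lemma common_denominator m (k : 'I_m -> rat) :
  exists2 D : int, D != 0 & forall i, exists c : int, D%:~R * k i = c%:~R.
Proof.
exists (\prod_j denq (k j)); first by apply/prodf_neq0 => j _; apply: denq_neq0.
move=> i; rewrite (bigD1 i) //=; set D := \prod_(_ | _) _.
by exists (D * numq (k i)); rewrite !rmorphM /= numqE; ring.
Qed.

(* Elements a_i lying in all the primes but the i-th are linearly independent
   over the rationals: an integral relation has all its coefficients divisible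
   by q, hence by every power of q. *)
Lemma primes_above_bound m (P : 'I_m -> set K) (q : nat) :
    prime q -> injective P -> (forall i, is_prime (P i)) ->
    (forall i, P i q%:R) ->
  (m <= \dim (fullv : {vspace K}))%N.
Proof.
move=> q_pr injP pP Pq.
(* Distinct primes are incomparable. The condition [j != i] sits under the existential so that [b]
   is a total function of both indices. *)
have sep i j : exists b, j != i -> P j b /\ ~ P i b.
  have [_|ji] := eqVneq j i; first by exists 0.
  apply: contrapT => nex; move/eqP: ji; apply; apply: injP.
  have PQ: (P j `<=` P i)%classic.
    by move=> b Pb; apply: contrapT => nPb; apply: nex; exists b.
  by apply/seteqP; split => //; apply: prime_incomparable.
pose b i j := sval (cid (sep i j)).
have bP i j : j != i -> P j (b i j) /\ ~ P i (b i j) := svalP (cid (sep i j)).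
pose a i := \prod_(j | j != i) b i j.
have ib i j : j != i -> integers (b i j).
  by move=> /bP[/(prime_sub (pP j))].
have ia i : integers (a i).
  apply: (big_ind (@integers K)) => [|x y|j /ib//]; last exact: integersM.
  exact: integers_nat 1%N.
have nPa i : ~ P i (a i).
  suff [] : integers (a i) /\ ~ P i (a i) by [].
  apply: (big_ind (fun x => integers x /\ ~ P i x)) => [|x y [ix nx] [iy ny]|j ji].
  - by split; [apply: integers_nat 1%N | apply: prime_proper].
  - by split; [apply: integersM | move=> /(prime_mul (pP i) ix iy)[]].
  - by split; [apply: ib | have [] := bP i j ji].
have Pa i j : j != i -> P j (a i).
  move=> ji; rewrite /a (bigD1 j) //= mulrC; apply: (prime_mull (pP j)).
    apply: (big_ind (@integers K)) => [|x y|l /andP[/ib]//]; last exact: integersM.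
    exact: integers_nat 1%N.
  by have [] := bP i j ji.
(* Modulo [P j] only the [j]-th term survives, and [a j] is not in [P j], so [q] divides [c j].
   Dividing the relation by [q] repeats the argument. *)
have dvd e (c : 'I_m -> int) : \sum_i (c i)%:~R * a i = 0 ->
    forall i, exists k, c i = k * (q ^ e)%N%:Z.
  elim: e c => [|e IH] c c0 i; first by exists (c i); rewrite mulr1.
  have qc j : exists k, c j = k * q%:Z.
    apply: (prime_int_dvd (pP j)) => //.
    have: P j ((c j)%:~R * a j).
      have/eqP := c0; rewrite (bigD1 j) //= addr_eq0 => /eqP->.
      apply: primeN => //; apply: (big_ind (P j)) => [|x y|l lj].
      - exact: prime0.
      - exact: prime_add.
      - by apply: prime_mulz => //; apply: Pa; rewrite eq_sym.
    by move/(prime_mul (pP j) (integers_int _ _) (ia j)) => [|/nPa].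
  have [c' ec'] := choice qc.
  have [|k ek] := IH c' _ i; last first.
    by exists k; rewrite ec' ek expnS PoszM; ring.
  have q0: (q%:R : K) != 0.
    by rewrite numfield_natr_eq0 -lt0n prime_gt0.
  apply: (mulfI q0); rewrite mulr0 -[RHS]c0 mulr_sumr.
  by apply: eq_bigr => j _; rewrite ec' rmorphM /=; ring.
have: free [tuple a i | i < m].
  apply/freeP => k k0 i; have [D D0 Dk] := common_denominator k.
  have [c ec] := choice Dk.
  have c0: \sum_i (c i)%:~R * a i = 0.
    rewrite -[RHS](scaler0 _ D%:~R) -[in RHS]k0 scaler_sumr.
    apply: eq_bigr => j _; rewrite scalerA ec scaler_int mulrzl.
    by rewrite (nth_map j) ?size_enum_ord // nth_ord_enum.
  have ci0: c i = 0.
    (* The exponent [|c i|] is large enough, since n < q^n: only 0 is divisible by that power. *)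
    have [l el] := dvd `|c i|%N c c0 i; apply/eqP; rewrite -absz_eq0.
    apply: contraTT (ltn_expl `|c i|%N (prime_gt1 q_pr)) => ci0.
    rewrite -leqNgt {2}el abszM /= leq_pmull // lt0n.
    by apply: contra ci0 => l0; rewrite el abszM (eqP l0).
  have/eqP := ec i; rewrite ci0 mulf_eq0 intr_eq0 (negPf D0) /=.
  by move/eqP.
by move=> /eqP e; rewrite -[m in (m <= _)%N](size_tuple [tuple a i | i < m]) -e dimvS ?subvf.
Qed.

End PrimesAboveRational.

(** If no list of length at most [n] covered [A], then [n.+1] distinct elements of [A] could be
    chosen one after the other. *)
Lemma seq_cover (T : eqType) (A : T -> Prop) n :
    (forall m (f : 'I_m -> T), injective f -> (forall i, A (f i)) -> (m <= n)%N) ->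
  exists2 s : seq T, (size s <= n)%N & forall x, A x -> x \in s.
Proof.
move=> bnd; apply: contrapT => nex.
have long m : (m <= n.+1)%N ->
    exists s : m.-tuple T, uniq s /\ forall i, A (tnth s i).
  elim: m => [|m IH] lm; first by exists [tuple]; split=> // -[].
  have [s [us As]] := IH (ltnW lm).
  have [x [Ax nx]]: exists x, A x /\ x \notin s.
    apply: contrapT => nx; apply: nex; exists s; first by rewrite size_tuple.
    by move=> x Ax; apply: contrapT => /negP xs; apply: nx; exists x.
  exists [tuple of x :: s]; rewrite /= nx us; split=> // i.
  case: (unliftP ord0 i) => [j|] ->; last by rewrite tnth0.
  by rewrite tnthS.
have [s [us As]] := long n.+1 (leqnn _).
by have := bnd _ (tnth s) (tuple_uniqP _ us) As; rewrite ltnn.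
Qed.

(** [good_curve] asks for the exact number of exceptional primes, while a covering list only bounds
    it. *)
Lemma card_covered (T : eqType) (S : set T) (s : seq T) :
    (forall x, S x -> x \in s) ->
  exists2 m, (m <= size s)%N & (S #= `I_m)%card.
Proof.
move=> Ss; have /finite_setP[m Sm]: finite_set S.
  by apply: sub_finite_set (finite_seq s) => x; apply: Ss.
exists m => //; rewrite -card_le_II -(card_le_eql Sm).
case: s Ss => [|x0 s] Ss.
  by rewrite (_ : S = set0) ?card_ge0 // -subset0 => x /Ss.
apply: card_le_trans (card_image_le (nth x0 (x0 :: s)) _).
apply: subset_card_le => x /Ss xs; exists (index x (x0 :: s)).
  by move: xs; rewrite -index_mem.
exact: nth_index.
Qed.

Section Cover.
Variable K : fieldExtType rat.

Lemma primes_above_cover (ps : seq nat) : all prime ps ->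
  exists2 s : seq (set K), (size s <= \dim (fullv : {vspace K}) * size ps)%N &
    forall (P : set K) q, is_prime P -> q \in ps -> P q%:R -> P \in s.
Proof.
elim: ps => [|p ps IH] /=; first by exists [::].
case/andP => p_pr /IH[s ss Ps].
have [|t ts Pt] := @seq_cover _ (fun P : set K => is_prime P /\ P p%:R)
    (\dim (fullv : {vspace K})).
  move=> m P injP AP; apply: (primes_above_bound p_pr injP) => i;
  by have [] := AP i.
exists (t ++ s); first by rewrite size_cat mulnS leq_add.
move=> P q pP; rewrite inE mem_cat => /orP[/eqP-> Pp|qps Pq].
  by rewrite Pt.
by rewrite (Ps P q) ?orbT.
Qed.

Lemma primes_fact_cover k :
  exists2 s : seq (set K), (size s <= \dim (fullv : {vspace K}) * prime_pi k)%N &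
    forall P : set K, is_prime P -> P k`!%:R -> P \in s.
Proof.
have [|s ss Ps] := @primes_above_cover
  [seq val p | p <- enum [set p : 'I_k.+1 | prime p]%SET].
  by apply/allP => q /mapP[p]; rewrite mem_enum inE => p_pr ->.
exists s; first by move: ss; rewrite size_map -cardE.
move=> P pP Pk.
have [q [q_pr lqk Pq]]: exists q, [/\ prime q, (q <= k)%N & P q%:R].
  elim: k {s ss Ps} Pk => [/(prime_proper pP)//|k IH].
  rewrite factS natrM => /(prime_mul pP (integers_nat _ _) (integers_nat _ _)).
  case=> [/(natz_prime_factor pP)//|/IH[q [q_pr lq Pq]]].
  by exists q; split=> //; apply: leqW.
apply: (Ps P q) => //; apply/mapP.
by exists (Ordinal (lqk : (q < k.+1)%N)) => //; rewrite mem_enum inE.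
Qed.

End Cover.

(** * Isomorphisms of hyperelliptic function fields *)

Section Bivariate.
Variable F : closedFieldType.
Implicit Types (c d : {poly F}) (U G : {poly {poly F}}).

(** For U in F[t][X]: if all coefficients vanish at t = a, then t - a divides the content. *)
Lemma map_horner_eval_eq0 (a : F) U :
  map_poly (horner_eval a) U = 0 -> exists V, U = ('X - a%:P) *: V.
Proof.
move=> U0; exists (map_poly (fun p : {poly F} => p %/ ('X - a%:P)) U).
apply/polyP => i; rewrite coefZ coef_map_id0 ?div0p //.
rewrite mulrC divpK // dvdp_XsubCl; apply/rootP.
by have := congr1 (fun p : {poly F} => p`_i) U0; rewrite coef_map coef0.
Qed.

(** As [F] is closed, [c] splits into linear factors, which are cancelled one at a time against the
    content of [G] or of [H]. What is cancelled from [G] is collected in [d]. *)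
Lemma gauss c U G H : c != 0 -> c *: U = G * H ->
  exists (d : {poly F}) (G0 H0 : {poly {poly F}}), [/\ d != 0, G = d *: G0 & U = G0 * H0].
Proof.
have [n] := ubnP (size c); elim: n c U G H => // n IH c U G H sc c0 e.
have [sc1|sc1] := eqVneq (size c) 1%N.
  have [a a0 ca] := size_poly1P _ (introT eqP sc1).
  exists 1, G, (a^-1%:P *: H); rewrite oner_neq0 scale1r; split=> //.
  by rewrite -scalerAr -e scalerA ca -polyCM mulVf // scale1r.
have [a /factor_theorem[c' ec]] := closed_rootP c sc1.
have c'0: c' != 0 by apply: contraNneq c0 => c'0; rewrite ec c'0 mul0r.
have sc': (size c' < n)%N.
  by move: sc; rewrite ec size_Mmonic ?monicXsubC // size_XsubC addn2.
have Xa0: 'X - a%:P != 0 :> {poly F} by rewrite polyXsubC_eq0.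
have XaC0: ('X - a%:P)%:P != 0 :> {poly {poly F}} by rewrite polyC_eq0.
(* Specializing t to the root [a] of [c] kills the product in the domain F[X], so one of the two
   factors is killed. *)
have: map_poly (horner_eval a) G * map_poly (horner_eval a) H = 0.
  rewrite -rmorphM -e ec; apply/polyP => i; rewrite coef_map coefZ /= /horner_eval.
  by rewrite !hornerM hornerXsubC subrr mulr0 mul0r coef0.
move/eqP; rewrite mulf_eq0 => /orP[]/eqP/map_horner_eval_eq0[V eV].
  have [|d [G0 [H0 [d0 eG eU]]]] := IH c' U V H sc' c'0.
    by apply: (mulfI XaC0); rewrite !mul_polyC scalerA mulrC -ec e eV scalerAl.
  exists (('X - a%:P) * d), G0, H0; split=> //; first exact: mulf_neq0.
  by rewrite eV eG scalerA.
have [|d [G0 [H0 [d0 eG eU]]]] := IH c' U G V sc' c'0.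
  by apply: (mulfI XaC0); rewrite !mul_polyC scalerA mulrC -ec e eV scalerAr.
by exists d, G0, H0.
Qed.

(* G plays the role of a minimal polynomial of A over F(t); the polynomial U
   bounds its degree in t once the content is removed. *)
Lemma relation_sizeY (E : comNzRingType) (J : {rmorphism {poly F} -> E}) (A : E)
    G U :
    G != 0 -> U != 0 -> (map_poly J G).[A] = 0 -> (map_poly J U).[A] = 0 ->
    (forall V : {poly {poly F}}, (size V < size G)%N -> (map_poly J V).[A] = 0 -> V = 0) ->
  exists (d : {poly F}) (G0 : {poly {poly F}}), [/\ d != 0, G = d *: G0 & (sizeY G0 <= sizeY U)%N].
Proof.
move=> G0 U0 GA UA minG.
(* Pseudo-division over F[t]: the remainder also vanishes at [A], so it is 0 by minimality of
   [G]. *)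
have e := Pdiv.Idomain.divp_eq U G; set c := _ ^+ _ in e.
have c0: c != 0 by rewrite expf_neq0 // lead_coef_eq0.
have r0: U %% G = 0.
  apply: minG; first by rewrite Pdiv.Idomain.ltn_modpN0.
  have := congr1 (fun p => (map_poly J p).[A]) e.
  rewrite /= rmorphD rmorphM /= !hornerE GA mulr0 add0r => <-.
  by rewrite -mul_polyC rmorphM /= map_polyC /= hornerCM UA mulr0.
rewrite r0 addr0 mulrC in e.
have [d [G1 [H1 [d0 eG eU]]]] := gauss c0 e.
exists d, G1; split=> //; rewrite !sizeYE eU rmorphM.
have [G10 H10]: G1 != 0 /\ H1 != 0.
  by split; apply: contraNneq U0 => z; rewrite eU z ?mulr0 ?mul0r.
(* Degrees in t add up in a product, as is seen after swapping the variables. *)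
rewrite size_mul ?swapXY_eq0 //; have: (0 < size (swapXY H1))%N.
  by rewrite lt0n size_poly_eq0 swapXY_eq0.
by move=> H1_gt0; rewrite -subn1 -addnBA // leq_addr.
Qed.

(** The right side has odd multiplicity at [a], whereas [E ^+ 2] contributes an even one. *)
Lemma mup_parity (h w D E : {poly F}) (a : F) :
    h != 0 -> w != 0 -> D != 0 -> E != 0 ->
    h * E ^+ 2 = w * D ^+ 2 -> mup a w = 1%N -> root h a.
Proof.
move=> h0 w0 D0 E0 e wa; apply: contraT => ha.
have := congr1 (mup a) e.
rewrite !expr2 !mupM ?mulf_neq0 // (mupNroot ha) wa add0n !addnn.
by move/(congr1 odd); rewrite oddD !odd_double.
Qed.

End Bivariate.

Lemma fraction_repr (R : idomainType) (x : {fraction R}) :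
  exists n d : R, d != 0 /\ x = tofrac n / tofrac d.
Proof.
elim/quotW: x => x; exists (frac x).1, (frac x).2.
have d0 := denom_ratioP x; split=> //.
apply: (canRL (mulfK _)); first by rewrite tofrac_eq0.
unlock FracField.tofrac; rewrite -[LHS]FracField.pi_mul.
apply/eqmodP; rewrite /= FracField.equivfE /FracField.mulf /=.
by rewrite !numden_Ratio ?(oner_neq0, mulr1, mulf_neq0) // mulrC.
Qed.

Lemma fraction_repr2 (R : idomainType) (x y : {fraction R}) :
  exists m n d : R, [/\ d != 0, tofrac d * x = tofrac m & tofrac d * y = tofrac n].
Proof.
have [m [d [d0 ->]]] := fraction_repr x; have [n [e [e0 ->]]] := fraction_repr y.
have [d0' e0'] : tofrac d != 0 /\ tofrac e != 0 by rewrite !tofrac_eq0.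
exists (m * e), (n * d), (d * e); split; first exact: mulf_neq0.
  by rewrite !tofracM mulrAC [tofrac d * _]mulrCA divff // mulr1.
by rewrite !tofracM -mulrA [tofrac e * _]mulrCA divff // mulr1 mulrC.
Qed.

Section Evaluation.
Variables (F : fieldType) (E : comNzRingType) (J : {rmorphism {poly F} -> E}).
Variable A : E.

(** The F-algebra morphism from F[X] to [E] sending X to [A], where [E] is an F-algebra through [J]
    on constants. *)
Definition eval_const (p : {poly F}) : E := (map_poly (J \o polyC) p).[A].

Lemma eval_const_zmod : zmod_morphism eval_const.
Proof. by move=> p q; rewrite /eval_const rmorphB hornerD hornerN. Qed.

Lemma eval_const_monoid : monoid_morphism eval_const.
Proof.
by split=> [|p q]; rewrite /eval_const ?rmorph1 ?hornerC ?rmorphM ?hornerM.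
Qed.

HB.instance Definition _ :=
  GRing.isZmodMorphism.Build {poly F} E eval_const eval_const_zmod.
HB.instance Definition _ :=
  GRing.isMonoidMorphism.Build {poly F} E eval_const eval_const_monoid.

Lemma eval_constX : eval_const 'X = A.
Proof. by rewrite /eval_const map_polyX hornerX. Qed.

Lemma eval_constC c : eval_const c%:P = J c%:P.
Proof. by rewrite /eval_const map_polyC hornerC. Qed.

(** Both sides are the value of one bivariate polynomial at the pair ([A], [J 'X]). This turns an
    equation of t over F[phi x] into an equation of phi x over F[t]. *)
Lemma eval_swapXY (p : {poly {poly F}}) :
  (map_poly J (swapXY p)).[A] = (map_poly eval_const p).[J 'X].
Proof.
elim/poly_ind: p => [|p c IH]; first by rewrite !rmorph0 !horner0.
rewrite rmorphD rmorphM /= swapXY_X swapXY_polyC !rmorphD !rmorphM /=.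
rewrite !map_polyC map_polyX !hornerE IH /=; congr (_ + _).
by rewrite -map_poly_comp.
Qed.

Lemma eval_const_ext (phi : {rmorphism {poly F} -> E}) p :
    (forall c, phi c%:P = J c%:P) -> phi 'X = A -> phi p = eval_const p.
Proof.
move=> phiC phiX; elim/poly_ind: p => [|p c IH]; first by rewrite !rmorph0.
by rewrite !rmorphD !rmorphM /= IH phiC phiX eval_constX eval_constC.
Qed.

End Evaluation.

(** [E] is F(t) + F(t) s with s^2 = h, through coordinates only; the isomorphism argument is thus
    independent of the quotient construction of function fields. *)
Record quadratic_ext (F : fieldType) (h : {poly F}) (E : comNzRingType)
    (j : {rmorphism {fraction {poly F}} -> E}) (s : E) : Prop := QuadraticExt {
  quad_sq : s ^+ 2 = j (tofrac h);
  quad_gen : forall z, exists a b, z = j a + j b * s;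
  quad_free : forall a b, j a + j b * s = 0 -> a = 0 /\ b = 0 }.

Section QuadraticExt.
Variables (F : fieldType) (h : {poly F}) (E : comNzRingType).
Variables (j : {rmorphism {fraction {poly F}} -> E}) (s : E).
Hypothesis qE : quadratic_ext h j s.

Lemma quad_inj a : j a = 0 -> a = 0.
Proof. by move=> a0; case: (quad_free qE (a := a) (b := 0)) => //;
  rewrite a0 rmorph0 mul0r addr0. Qed.

Lemma quad_gen_poly z : exists m n d : {poly F}, d != 0 /\
  j (tofrac d) * z = j (tofrac m) + j (tofrac n) * s.
Proof.
have [a [b ->]] := quad_gen qE z; have [m [n [d [d0 em en]]]] := fraction_repr2 a b.
by exists m, n, d; split=> //; rewrite mulrDr mulrA -!rmorphM em en.
Qed.

End QuadraticExt.

(** This is the norm equation of (m + n s) / d, where s^2 = h, with denominators cleared. *)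
Lemma size_quad (F : fieldType) (m n d h : {poly F}) : d != 0 ->
  size ((d%:P * 'X - m%:P) ^+ 2 - (n ^+ 2 * h)%:P) = 3%N.
Proof.
move=> d0; have s2: size (d%:P * 'X - m%:P) = 2%N.
  by rewrite -polyCN size_MXaddC polyC_eq0 (negPf d0) /= size_polyC d0.
have s3: size ((d%:P * 'X - m%:P) ^+ 2) = 3%N.
  by rewrite expr2 size_mul ?s2 // -size_poly_eq0 s2.
by rewrite size_polyDl // size_polyN s3 size_polyC; case: (_ != 0).
Qed.

Section Isomorphism.
Variables (F : closedFieldType) (f h : {poly F}) (E1 E2 : comNzRingType).
Variables (j1 : {rmorphism {fraction {poly F}} -> E1}) (y : E1).
Variables (j2 : {rmorphism {fraction {poly F}} -> E2}) (s : E2).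
Hypotheses (q1 : quadratic_ext f j1 y) (q2 : quadratic_ext h j2 s).
Variable phi : {rmorphism E1 -> E2}.
Hypothesis phi_const : forall c : F,
  phi (j1 (tofrac c%:P)) = j2 (tofrac c%:P).
Hypothesis phi_surj : forall z, exists w, phi w = z.
Hypothesis phi_inj : forall w, phi w = 0 -> w = 0.
Hypothesis nz2 : (2%:R : F) != 0.

Let A := phi (j1 (tofrac 'X)).

Lemma phi_poly p : phi (j1 (tofrac p)) = eval_const (j2 \o @tofrac {poly F}) A p.
Proof.
by rewrite -(@eval_const_ext _ _ (j2 \o @tofrac {poly F}) A (phi \o (j1 \o @tofrac {poly F}))).
Qed.

(** Write t = phi w. The norm equation of w over F[x], carried over by [phi], has degree 2 in t;
    after the swap it is an equation of [A] whose coefficients have degree at most 2 in t. *)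
Lemma quad_relation : exists U : {poly {poly F}},
  [/\ U != 0, (sizeY U <= 3)%N & (map_poly (j2 \o @tofrac {poly F}) U).[A] = 0].
Proof.
have [w ew] := phi_surj (j2 (tofrac 'X)).
have [m [n [d [d0 e]]]] := quad_gen_poly q1 w.
pose U : {poly {poly F}} := (d%:P * 'X - m%:P) ^+ 2 - (n ^+ 2 * f)%:P.
have sU : size U = 3%N := size_quad m n f d0.
exists (swapXY U); split.
- by rewrite swapXY_eq0 -size_poly_eq0 sU.
- by rewrite sizeYE swapXYK sU.
rewrite eval_swapXY /U rmorphB rmorphXn rmorphB rmorphM /= !map_polyC map_polyX.
rewrite !hornerE /= -!phi_poly -ew -rmorphM e -rmorphB [_ - j1 (tofrac m)]addrC addKr.
by rewrite -rmorphXn exprMn (quad_sq q1) !(rmorphM, rmorphXn) /= subrr.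
Qed.

Lemma phi_x_rational (rs : seq F) :
    h != 0 -> uniq rs -> (5 <= size rs)%N -> {in rs, forall r, mup r h = 1%N} ->
  exists a, A = j2 a.
Proof.
move=> h0 urs srs hrs; have [a [b eA]] := quad_gen q2 A.
have [b0|b0] := eqVneq b 0; first by exists a; rewrite eA b0 rmorph0 mul0r addr0.
exfalso.
have [m [n [r [r0 em en]]]] := fraction_repr2 a b.
have n0: n != 0 by rewrite -tofrac_eq0 -en mulf_neq0 ?tofrac_eq0.
(* [G] is the norm equation of [A] over F(t). It has minimal degree because [b] is nonzero, which
   makes 1 and [A] independent. *)
pose G : {poly {poly F}} := (r%:P * 'X - m%:P) ^+ 2 - (n ^+ 2 * h)%:P.
have sG : size G = 3%N := size_quad m n h r0.
have [U [U0 sU UA]] := quad_relation.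
have G0: G != 0 by rewrite -size_poly_eq0 sG.
have GA: (map_poly (j2 \o @tofrac {poly F}) G).[A] = 0.
  rewrite /G rmorphB rmorphXn rmorphB rmorphM /= !map_polyC map_polyX.
  rewrite !hornerE /= eA mulrDr mulrA -!rmorphM em en [_ - j2 (tofrac m)]addrC addKr.
  by rewrite exprMn (quad_sq q2) !(rmorphM, rmorphXn) /= subrr.
have minG (V : {poly {poly F}}) : (size V < size G)%N ->
    (map_poly (j2 \o @tofrac {poly F}) V).[A] = 0 -> V = 0.
  rewrite sG ltnS => sV; rewrite (horner_coef_wide _ (n := 2)); last first.
    by rewrite (leq_trans (size_poly _ _)).
  rewrite !big_ord_recl big_ord0 /= !coef_map /= mulr1 addr0 eA => e.
  have [|e0 /eqP] := quad_free q2 (a := tofrac V`_0 + tofrac V`_1 * a)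
    (b := tofrac V`_1 * b).
    by rewrite -[RHS]e rmorphD !rmorphM /=; ring.
  rewrite mulf_eq0 (negPf b0) orbF tofrac_eq0 => /eqP V1.
  move: e0; rewrite V1 rmorph0 mul0r addr0 => /eqP; rewrite tofrac_eq0 => /eqP V0.
  by apply/polyP => -[|[|i]]; rewrite coef0 //; apply/nth_default/(leq_trans sV).
have [d [H [d0 eG sH]]] := relation_sizeY G0 U0 GA UA minG.
have gE i : d * H`_i = G`_i by rewrite eG coefZ.
have [G0E G1E G2E]: [/\ G`_0 = m ^+ 2 - n ^+ 2 * h, G`_1 = - (r * m *+ 2) &
    G`_2 = r ^+ 2].
  rewrite (_ : G = (r ^+ 2)%:P * 'X ^+ 2 + (- (r * m *+ 2))%:P * 'X
     + (m ^+ 2 - n ^+ 2 * h)%:P); last first.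
    have expand (R : comNzRingType) (x u v k : R) : (u * x - v) ^+ 2 - k =
      u ^+ 2 * x ^+ 2 + (- (u * v *+ 2)) * x + (v ^+ 2 - k) by ring.
    by rewrite /G expand !(polyCB, polyCMn, polyCN, polyCM, polyC_exp).
  by rewrite !coefD !coefCM !coefC !coefXn !coefX /= !mulr0 !mulr1 !addr0 !add0r.
(* [D] is the discriminant of the primitive equation [H]; that of [G] is [d ^+ 2] times it, and
   equals h (2 r n)^2. *)
pose D := H`_1 ^+ 2 - H`_0 * H`_2 *+ 4.
have eD: D * d ^+ 2 = h * (r * n *+ 2) ^+ 2.
  have clear (R : comNzRingType) (x u v k : R) : (u ^+ 2 - v * k *+ 4) * x ^+ 2 =
    (x * u) ^+ 2 - (x * v) * (x * k) *+ 4 by ring.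
  have disc (R : comNzRingType) (x u v k : R) :
    (- (u * v *+ 2)) ^+ 2 - (v ^+ 2 - x ^+ 2 * k) * u ^+ 2 *+ 4 =
    k * (u * x *+ 2) ^+ 2 by ring.
  by rewrite /D clear !gE G0E G1E G2E disc.
have rn0: r * n *+ 2 != 0.
  rewrite -mulr_natr mulf_neq0 ?mulf_neq0 //.
  by rewrite -[2%:R](rmorph_nat polyC) polyC_eq0.
have D0: D != 0.
  apply/eqP => D0; move/esym/eqP: eD; rewrite D0 mul0r mulf_eq0 (negPf h0) /=.
  by rewrite expf_eq0 (negPf rn0).
have sD: (size D <= 5)%N.
  have sHi i : (size (H`_i)%R <= 3)%N.
    by apply: leq_trans (max_size_coefXY _ _) (leq_trans sH sU).
  have sM (p q : {poly F}) : (size p <= 3)%N -> (size q <= 3)%N -> (size (p * q)%R <= 5)%N.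
    move=> sp sq; apply: leq_trans (size_polyMleq _ _) _.
    by rewrite -subn1 leq_subLR (leq_add sp sq).
  apply: leq_trans (size_polyD _ _) _; rewrite geq_max size_polyN expr2 sM //=.
  by rewrite -scaler_nat (leq_trans (size_scale_leq _ _)) // sM.
(* By parity every simple root of [h] is a root of [D]: at least 5 roots for a degree of at most
   4. *)
have /(max_poly_roots D0)/(_ urs): all (root D) rs.
  by apply/allP => x xrs; apply: (mup_parity D0 h0 rn0 d0 eD (hrs x xrs)).
by move/leq_trans/(_ sD)/(leq_ltn_trans srs); rewrite ltnn.
Qed.

(* By surjectivity of phi, t itself is a rational function of a, so a has
   degree one. *)
Lemma phi_moebius a : A = j2 a ->
  (exists P Q : {poly F}, [/\ (size P <= 2)%N, (size Q <= 2)%N,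
    forall c, P != c *: Q, Q != 0 & tofrac Q * a = tofrac P]) /\
  exists b, b ^+ 2 * tofrac h = eval_const (@tofrac {poly F}) a f.
Proof.
move=> eA; pose ev := eval_const (@tofrac {poly F}) a.
have phi_ev p : phi (j1 (tofrac p)) = j2 (ev p).
  rewrite phi_poly -/A eA -(@eval_const_ext _ _ (j2 \o @tofrac {poly F}) (j2 a) (j2 \o ev)) //=.
    by move=> c; rewrite /ev eval_constC.
  by rewrite /ev eval_constX.
have ev_inj p : ev p = 0 -> p = 0.
  move=> p0; apply/eqP; rewrite -tofrac_eq0; apply/eqP/(quad_inj q1)/phi_inj.
  by rewrite phi_ev p0 rmorph0.
have F2 : (2%:R : {fraction {poly F}}) != 0.
  by rewrite -(rmorph_nat (@tofrac {poly F})) tofrac_eq0 -(rmorph_nat polyC) polyC_eq0.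
have [c [d eB]] := quad_gen q2 (phi y).
(* Compare the coordinates on 1 and [s] in (phi y)^2 = f(a), with phi y = c + d s. *)
have [cd0 cd]: c * d = 0 /\ c ^+ 2 + d ^+ 2 * tofrac h = ev f.
  have e : phi y ^+ 2 = j2 (ev f) by rewrite -rmorphXn (quad_sq q1) phi_ev.
  have [|e1 e2] := quad_free q2 (a := c ^+ 2 + d ^+ 2 * tofrac h - ev f)
     (b := 2%:R * (c * d)).
    rewrite rmorphB -e eB !(rmorphD, rmorphM, rmorphXn) rmorph1 /= -(quad_sq q2).
    by ring.
  split; last by apply/eqP; rewrite -subr_eq0 e1.
  by move/eqP: e2; rewrite mulf_eq0 (negPf F2) => /eqP.
(* If [c] is nonzero, then [d = 0] and phi x, phi y both lie in F(t); the image of [phi] would then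
   miss [s]. *)
have [c0|c0] := eqVneq c 0; last first.
  have d0: d = 0 by move/eqP: cd0; rewrite mulf_eq0 (negPf c0) => /eqP.
  have [w ew] := phi_surj s.
  have [m [n [e [e0 ee]]]] := quad_gen_poly q1 w.
  have := congr1 phi ee; rewrite rmorphM rmorphD rmorphM !phi_ev ew eB d0.
  rewrite rmorph0 mul0r addr0 => es.
  have [|_ /ev_inj /eqP] := quad_free q2 (a := - (ev m + ev n * c)) (b := ev e).
    by rewrite es !(rmorphN, rmorphD, rmorphM) addNr.
  by rewrite (negPf e0).
rewrite c0 rmorph0 add0r in eB; rewrite c0 expr0n add0r in cd.
split; last by exists d.
(* Now phi y is a multiple of [s], so the coordinate on 1 of a preimage of t expresses t as m(a) /
   n(a). *)
have [m [n [e0 emn]]] : exists m n : {poly F}, n != 0 /\ ev n * tofrac 'X = ev m.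
  have [w ew] := phi_surj (j2 (tofrac 'X)).
  have [m [n [e [e0 ee]]]] := quad_gen_poly q1 w.
  have := congr1 phi ee; rewrite rmorphM rmorphD rmorphM !phi_ev ew eB => es.
  exists m, e; split=> //; apply/eqP; rewrite -subr_eq0; apply/eqP.
  have [|//] := quad_free q2 (a := ev e * tofrac 'X - ev m) (b := - (ev n * d)).
  by rewrite !(rmorphB, rmorphN, rmorphM) /= es; ring.
(* The relation n(a) t = m(a) has degree one in t, and this bounds by one the degree in t of the
   primitive linear equation of [a]. *)
pose U : {poly {poly F}} := swapXY (n%:P * 'X - m%:P).
have sU: sizeY U = 2%N.
  by rewrite sizeYE swapXYK -polyCN size_MXaddC polyC_eq0 (negPf e0) /= size_polyC e0.
have UA : (map_poly (@tofrac {poly F}) U).[a] = 0.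
  rewrite eval_swapXY rmorphB rmorphM /= map_polyX !map_polyC !hornerE /=.
  by rewrite emn subrr.
have [p [r [r0 ea]]] := fraction_repr a.
have rF0 : tofrac r != 0 by rewrite tofrac_eq0.
pose G : {poly {poly F}} := r%:P * 'X - p%:P.
have sG: size G = 2%N.
  by rewrite /G -polyCN size_MXaddC polyC_eq0 (negPf r0) /= size_polyC r0.
have GA : (map_poly (@tofrac {poly F}) G).[a] = 0.
  rewrite /G rmorphB rmorphM /= map_polyX !map_polyC !hornerE /= ea mulrC divfK //.
  by rewrite subrr.
have [||V|k [H [k0 eG sH]]] := relation_sizeY (G := G) (U := U) _ _ GA UA.
- by rewrite -size_poly_eq0 sG.
- by rewrite -sizeY_eq0 sU.
- rewrite sG ltnS => /size1_polyC ->; rewrite map_polyC hornerC /= => /eqP.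
  by rewrite tofrac_eq0 => /eqP ->.
have gE i : k * H`_i = G`_i by rewrite eG coefZ.
have er : r = k * H`_1.
  by rewrite gE /G coefB coefCM coefX mulr1 coefC subr0.
have ep : p = k * - H`_0.
  by rewrite mulrN gE /G coefB coefCM coefX mulr0 coefC sub0r opprK.
have sHi i : (size (H`_i)%R <= 2)%N.
  by rewrite -sU (leq_trans (max_size_coefXY _ _)).
have Q0 : H`_1 != 0 by apply: contraNneq r0; rewrite er => ->; rewrite mulr0.
have eQ : tofrac H`_1 * a = tofrac (- H`_0).
  have kF0 : tofrac k != 0 by rewrite tofrac_eq0.
  apply: (mulfI kF0).
  rewrite mulrA -tofracM -er -tofracM -ep.
  by rewrite ea mulrCA (divff rF0) mulr1.
exists (- H`_0), H`_1; split=> //; first by rewrite size_polyN.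
(* Proportional [P] and [Q] would make [a] a constant, against the injectivity of [ev]. *)
move=> c1; apply/eqP => e1; move: eQ; rewrite e1 -mul_polyC tofracM mulrC.
have Q0' : tofrac H`_1 != 0 by rewrite tofrac_eq0.
move/(mulIf Q0') => ac; have /ev_inj/eqP: ev ('X - c1%:P) = 0.
  by rewrite /ev rmorphB /= eval_constX eval_constC ac subrr.
by rewrite polyXsubC_eq0.
Qed.

End Isomorphism.

(* Points of the projective line in homogeneous coordinates; [lin_at l p] is
   the value at p of the homogenization of the polynomial l of degree <= 1. *)
Section CrossRatio.
Variable F : fieldType.
Implicit Types (p q : F * F) (l P Q : {poly F}).

Definition pt_det p q : F := p.1 * q.2 - p.2 * q.1.

(** For a polynomial of odd degree the point at infinity (1, 0) is a branch point too. *)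
Definition branch_points (hs : seq F) : seq (F * F) :=
  (1, 0) :: [seq (r, 1) | r <- hs].

Definition cross_ratio (pq rs : (F * F) * (F * F)) : F :=
  pt_det pq.1 rs.1 * pt_det pq.2 rs.2 / (pt_det pq.1 rs.2 * pt_det pq.2 rs.1).

(** Degenerate quadruples are kept: only the finiteness of this list is used. *)
Definition cross_ratios (hs : seq F) : seq F :=
  let pts := branch_points hs in let pairs := [seq (p, q) | p <- pts, q <- pts] in
  [seq cross_ratio pq rs | pq <- pairs, rs <- pairs].

Definition lin_at l p : F := l`_1 * p.1 + l`_0 * p.2.

Lemma lin_at_root l (a : F) : (size l <= 2)%N -> lin_at l (a, 1) = l.[a].
Proof.
move=> sl; rewrite (horner_coef_wide _ sl) !big_ord_recl big_ord0 /lin_at /=.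
by rewrite !mulr1 addr0 addrC.
Qed.

Lemma branch_point_neq0 hs p : p \in branch_points hs -> p != (0, 0).
Proof.
by rewrite inE => /orP[/eqP->|/mapP[r _ ->]]; rewrite xpair_eqE oner_eq0 ?andbF.
Qed.

(** A linear form vanishing at [p] is a multiple of the determinant with [p]. *)
Lemma lin_at_eq0P l p : p != (0, 0) -> lin_at l p = 0 ->
  exists c, l`_1 = c * p.2 /\ l`_0 = - (c * p.1).
Proof.
case: p => u v /=; rewrite xpair_eqE negb_and /lin_at /= => /orP[u0|v0] e.
  exists (- l`_0 / u); split; last by field.
  apply: (mulIf u0); transitivity (- (l`_0 * v)); last by field.
  by apply/eqP; rewrite -addr_eq0 e.
exists (l`_1 / v); split; first by field.
apply: (mulIf v0); transitivity (- (l`_1 * u)); last by field.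
by apply/eqP; rewrite -addr_eq0 addrC e.
Qed.

Lemma lin_at_common P Q p : (size P <= 2)%N -> (size Q <= 2)%N -> Q != 0 ->
  p != (0, 0) -> lin_at P p = 0 -> lin_at Q p = 0 -> exists c, P = c *: Q.
Proof.
move=> sP sQ Q0 p0 /(lin_at_eq0P p0)[c [P1 P0]] /(lin_at_eq0P p0)[d [Q1 Q0']].
have d0 : d != 0.
  apply: contraNneq Q0 => d0; apply/eqP/polyP => -[|[|i]]; rewrite coef0.
  - by rewrite Q0' d0 mul0r oppr0.
  - by rewrite Q1 d0 mul0r.
  - exact/nth_default/(leq_trans sQ).
exists (c / d); apply/polyP => -[|[|i]]; rewrite coefZ.
- by rewrite P0 Q0' mulrN mulrA divfK.
- by rewrite P1 Q1 mulrA divfK.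
- by rewrite !nth_default ?mulr0 // (leq_trans sP, leq_trans sQ).
Qed.

(** P / Q maps [p0], [pi], [px], [py] to 0, infinity, [x], [y]. As [P] and [Q] are multiples a and b
    of the determinants with [p0] and [pi], both scalars cancel in x / y. *)
Lemma cross_ratioE P Q (x y : F) p0 pi px py :
    (size P <= 2)%N -> (size Q <= 2)%N -> Q != 0 -> (forall c, P != c *: Q) ->
    p0 != (0, 0) -> pi != (0, 0) -> px != (0, 0) -> py != (0, 0) -> y != 0 ->
    lin_at P p0 = 0 -> lin_at Q pi = 0 ->
    lin_at (P - x *: Q) px = 0 -> lin_at (P - y *: Q) py = 0 ->
  x = y * cross_ratio (px, py) (p0, pi).
Proof.
move=> sP sQ Q0 nPQ n0 ni nx ny y0 eP eQ ex ey.
have common p : p != (0, 0) -> lin_at P p = 0 -> lin_at Q p <> 0.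
  move=> np e1 e2; have [c ec] := lin_at_common sP sQ Q0 np e1 e2.
  by move: (nPQ c); rewrite ec eqxx.
have linB p z : lin_at (P - z *: Q) p = lin_at P p - z * lin_at Q p.
  by rewrite /lin_at !coefB !coefZ; ring.
rewrite !linB in ex ey; move/eqP: ex; rewrite subr_eq0 => /eqP ex.
move/eqP: ey; rewrite subr_eq0 => /eqP ey.
have [a [P1 P0]] := lin_at_eq0P n0 eP.
have [b [Q1 Q0']] := lin_at_eq0P ni eQ.
have Pdet p : lin_at P p = a * pt_det p p0 by rewrite /lin_at /pt_det P1 P0; ring.
have Qdet p : lin_at Q p = b * pt_det p pi by rewrite /lin_at /pt_det Q1 Q0'; ring.
have Qx : lin_at Q px != 0.
  by apply/eqP => z; apply: (common px) => //; rewrite ex z mulr0.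
have Py : lin_at P py != 0.
  apply/eqP => z; apply: (common py) => //; move/eqP: ey.
  by rewrite z eq_sym mulf_eq0 (negPf y0) => /eqP.
rewrite /cross_ratio /=.
have [b0 dxi] : b != 0 /\ pt_det px pi != 0.
  by move: Qx; rewrite Qdet mulf_eq0 negb_or => /andP.
have [a0 dy0] : a != 0 /\ pt_det py p0 != 0.
  by move: Py; rewrite Pdet mulf_eq0 negb_or => /andP.
rewrite !Pdet !Qdet in ex ey.
have key : x * (pt_det px pi * pt_det py p0) = y * (pt_det px p0 * pt_det py pi).
  have ab0 : a * b != 0 by rewrite mulf_neq0.
  apply: (mulfI ab0).
  transitivity ((x * (b * pt_det px pi)) * (a * pt_det py p0)); first by ring.
  by rewrite -ex ey; ring.
by rewrite mulrA -key mulfK // mulf_neq0.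
Qed.

End CrossRatio.

Lemma mup_linear (F : fieldType) (l : {poly F}) (a : F) :
  l != 0 -> (size l <= 2)%N -> root l a -> mup a l = 1%N.
Proof.
move=> l0 sl la; apply/eqP; rewrite eqn_leq mup_leq // mup_geq // expr1.
rewrite dvdp_XsubCl la andbT; apply/negP => /(dvdp_leq l0).
by rewrite size_exp_XsubC => /leq_trans/(_ sl).
Qed.

Section BranchPoints.
Variables (F : closedFieldType) (rs hs : seq F).
Let f : {poly F} := \prod_(a <- rs) ('X - a%:P).
Let h : {poly F} := \prod_(a <- hs) ('X - a%:P).
Variables (E1 E2 : comNzRingType).
Variables (j1 : {rmorphism {fraction {poly F}} -> E1}) (y : E1).
Variables (j2 : {rmorphism {fraction {poly F}} -> E2}) (s : E2).
Hypotheses (q1 : quadratic_ext f j1 y) (q2 : quadratic_ext h j2 s).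
Variable phi : {rmorphism E1 -> E2}.
Hypothesis phi_const : forall c : F,
  phi (j1 (tofrac c%:P)) = j2 (tofrac c%:P).
Hypothesis phi_surj : forall z, exists w, phi w = z.
Hypothesis phi_inj : forall w, phi w = 0 -> w = 0.
Hypothesis nz2 : (2%:R : F) != 0.
Hypotheses (rs_uniq : uniq rs) (hs_uniq : uniq hs).
Hypotheses (rs_odd : odd (size rs)) (hs_ge5 : (5 <= size hs)%N).

Lemma iso_cross_ratio x z : 0 \in rs -> x \in rs -> z \in rs -> z != 0 ->
  exists2 c, c \in cross_ratios hs & x = z * c.
Proof.
move=> rs0 rsx rsz z0.
have h0 : h != 0 by rewrite monic_neq0 ?monic_prod_XsubC.
have [|a ea] := phi_x_rational q1 q2 phi_const phi_surj nz2 h0 hs_uniq hs_ge5.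
  by move=> r rr; rewrite mu_prod_XsubC count_uniq_mem ?rr.
have [[P [Q [sP sQ nPQ Q0 eQ]]] [b eb]] :=
  phi_moebius q1 q2 phi_const phi_surj phi_inj nz2 ea.
have [m [d [d0 ebm]]] := fraction_repr b.
have PQ0 r : P - r *: Q != 0 by rewrite subr_eq0.
(* The product is f(a) homogenized by Q^(deg f); as deg f is odd, one more factor [Q] makes the
   power of [Q] a square. So [W] and [h] agree up to squares. *)
pose W := Q * \prod_(r <- rs) (P - r *: Q).
have prod0 : \prod_(r <- rs) (P - r *: Q) != 0.
  by rewrite prodf_seq_neq0; apply/allP => r _; apply: PQ0.
have W0 : W != 0 by rewrite mulf_neq0.
have eW : h * (m * Q ^+ uphalf (size rs)) ^+ 2 = W * d ^+ 2.
  apply/eqP; rewrite -tofrac_eq; apply/eqP.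
  have dF0 : tofrac d != 0 by rewrite tofrac_eq0.
  have ef : eval_const (@tofrac {poly F}) a f = \prod_(r <- rs) (a - tofrac r%:P).
    rewrite rmorph_prod; apply: eq_bigr => r _.
    by rewrite rmorphB /= eval_constX eval_constC.
  have eP : tofrac (\prod_(r <- rs) (P - r *: Q)) =
      tofrac Q ^+ size rs * \prod_(r <- rs) (a - tofrac r%:P).
    elim: (rs) => [|r s' IH]; first by rewrite !big_nil mulr1 tofrac1.
    rewrite !big_cons tofracM IH exprS mulrACA; congr (_ * _).
    by rewrite tofracB -mul_polyC tofracM mulrBr eQ [_ * tofrac r%:P]mulrC.
  rewrite !(tofracM, tofracXn) eP -ef -eb.
  have -> : tofrac m = b * tofrac d by rewrite ebm divfK.
  have key1 (R : comNzRingType) (q qn u v w : R) :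
    q * (qn * (u ^+ 2 * v)) * w ^+ 2 = (q * qn) * (u ^+ 2 * v * w ^+ 2) by ring.
  have key2 (R : comNzRingType) (u v w q : R) :
    v * (u * w * q) ^+ 2 = q ^+ 2 * (u ^+ 2 * v * w ^+ 2) by ring.
  rewrite key1 -exprS key2 -exprM; congr (_ ^+ _ * _).
  by rewrite muln2 uphalfE halfK /= rs_odd subn0.
have m0 : m != 0.
  apply/eqP => m0; move/esym/eqP: eW; rewrite m0 mul0r expr0n mulr0.
  by rewrite mulf_eq0 expf_eq0 /= (negPf W0) (negPf d0).
have mW0 : m * Q ^+ uphalf (size rs) != 0 by rewrite mulf_neq0 ?expf_neq0.
have root_h t : mup t W = 1%N -> t \in hs.
  by rewrite -root_prod_XsubC; apply: mup_parity eW.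
have nroot t : root P t -> ~~ root Q t.
  move=> /rootP Pt; apply/negP => /rootP Qt.
  have [|||c ec] := lin_at_common (p := (t, 1)) sP sQ Q0.
  - by rewrite xpair_eqE oner_eq0 andbF.
  - by rewrite lin_at_root.
  - by rewrite lin_at_root.
  by have := nPQ c; rewrite ec eqxx.
(* A constant form vanishes at infinity; otherwise its root is a simple root of [W], hence a root of
   [h]. The forms [Q] and [P - r *: Q] qualify, having no common zeros pairwise. *)
have zero (l : {poly F}) : l != 0 -> (size l <= 2)%N -> (forall t, root l t -> mup t W = 1%N) ->
    exists2 p, p \in branch_points hs & lin_at l p = 0.
  move=> l0 sl lW; have [s1|s1] := leqP (size l) 1.
    exists (1, 0); rewrite ?mem_head // /lin_at nth_default //= mul0r mulr0 addr0 //.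
  have /closed_rootP[t lt] : size l != 1%N by rewrite neq_ltn s1 orbT.
  exists (t, 1); last by rewrite lin_at_root //; apply/rootP.
  by rewrite inE map_f ?orbT // root_h // lW.
have sPQ r : (size (P - r *: Q)%R <= 2)%N.
  rewrite (leq_trans (size_polyD _ _)) // geq_max sP size_polyN.
  exact: leq_trans (size_scale_leq _ _) sQ.
have [pi hpi Qpi] : exists2 p, p \in branch_points hs & lin_at Q p = 0.
  apply: zero => // t Qt; rewrite mupMl ?mup_linear //.
  rewrite /root horner_prod prodf_seq_neq0; apply/allP => r _.
  apply/negP; rewrite !hornerE (rootP Qt) mulr0 subr0 => /nroot.
  by rewrite Qt.
have zeror r : r \in rs -> exists2 p, p \in branch_points hs & lin_at (P - r *: Q) p = 0.
  move=> rr; apply: zero => // t; rewrite /root !hornerE subr_eq0 => /eqP Pt.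
  have Qt : Q.[t] != 0.
    apply/eqP => Qt; have /nroot : root P t by rewrite /root Pt Qt mulr0.
    by rewrite /root Qt eqxx.
  rewrite /W mupMr // (big_rem r) //= mupMl ?mup_linear //.
    by rewrite /root !hornerE Pt subrr.
  rewrite /root horner_prod prodf_seq_neq0; apply/allP => r' /=.
  rewrite mem_rem_uniq // inE => /andP[r'r _].
  rewrite !hornerE Pt -mulrBl mulf_eq0 (negPf Qt) orbF subr_eq0 eq_sym.
  exact: r'r.
have [p0 hp0] := zeror 0 rs0; rewrite scale0r subr0 => ep0.
have [px hpx epx] := zeror x rsx; have [pz hpz epz] := zeror z rsz.
exists (cross_ratio (px, pz) (p0, pi)); first by do 3!apply: allpairs_f => //.
by apply: (cross_ratioE sP sQ Q0 nPQ _ _ _ _ z0 ep0 Qpi epx epz);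
  apply: branch_point_neq0; eassumption.
Qed.

End BranchPoints.

Definition split_curve (F : fieldType) (rs : seq F) : weierstrass F :=
  Weierstrass 0 (\prod_(a <- rs) ('X - a%:P)).

Lemma map_split_curve (F F' : fieldType) (f : {rmorphism F -> F'}) rs :
  map_weierstrass f (split_curve rs) = split_curve (map f rs).
Proof.
rewrite /map_weierstrass /split_curve /= rmorph0; congr Weierstrass.
by rewrite rmorph_prod big_map; apply: eq_bigr => a _; rewrite /= map_polyXsubC.
Qed.

Lemma linear_poly_eq0 (R : nzRingType) (a b : R) :
  a%:P + b%:P * 'X = 0 -> a = 0 /\ b = 0.
Proof.
move=> e; split.
  have := congr1 (fun p : {poly R} => p`_0) e.
  by rewrite /= coefD coefC coefMX coef0 addr0.
have := congr1 (fun p : {poly R} => p`_1) e.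
by rewrite /= coefD coefC coefMX coefC coef0 add0r.
Qed.

(** * The function field of a split curve as a quadratic extension *)

Section FunctionField.
Variables (F : fieldType) (rs : seq F).
Let C := split_curve rs.
Let m := function_field_poly C.
Let K0 : comNzRingType := {poly %/ m}.

Lemma function_field_polyE : m = 'X^2 - (tofrac (wP C))%:P.
Proof. by rewrite /m /function_field_poly /= tofrac0 polyC0 mul0r addr0. Qed.

Lemma size_function_field_poly : size m = 3%N.
Proof.
by rewrite function_field_polyE size_polyDl ?size_polyXn // size_polyN size_polyC;
   case: (_ != 0).
Qed.

Lemma function_field_poly_monic : m \is monic.
Proof.
rewrite monicE lead_coefE size_function_field_poly function_field_polyE.
by rewrite coefB coefXn coefC subr0.
Qed.

(** The quotient ring is computed modulo [mk_monic m], which differs from [m] unless [m] is monic of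
    positive degree. *)
Lemma mk_monic_function_field : mk_monic m = m.
Proof.
by rewrite /mk_monic size_function_field_poly function_field_poly_monic.
Qed.

Definition ff_embed : {rmorphism {fraction {poly F}} -> K0} := qpolyC m.

Lemma function_field_quadratic : quadratic_ext (wP C) ff_embed ('qX : K0).
Proof.
have valX : ('qX : {poly %/ m}) = 'X :> {poly {fraction {poly F}}}.
  by apply: qpolyXE; rewrite ?size_function_field_poly ?function_field_poly_monic.
have valD a b : (ff_embed a + ff_embed b * ('qX : K0) : {poly %/ m}) =
    a%:P + b%:P * 'X :> {poly {fraction {poly F}}}.
  rewrite poly_of_qpolyD poly_of_qpolyM valX /= mk_monic_function_field Pdiv.Ring.rmodp_small //.
  rewrite size_function_field_poly.
  by apply: leq_ltn_trans (size_polyMleq _ _) _; rewrite size_polyX size_polyC; case: (_ != 0).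
split.
- apply: val_inj; rewrite -[LHS]/(polyn (qpolyX m ^+ 2)) poly_of_qpolyX valX
    -[RHS]/((tofrac (wP C))%:P) mk_monic_function_field.
  have -> : 'X^2 = 1 * m + (tofrac (wP C))%:P.
    by rewrite mul1r function_field_polyE subrK.
  rewrite Pdiv.RingMonic.rmodp_addl_mul_small ?function_field_poly_monic //.
  rewrite size_function_field_poly size_polyC.
  by case: (_ != 0).
- move=> z; exists (polyn z)`_0, (polyn z)`_1; apply: val_inj.
  apply: etrans (esym (valD _ _)); apply/polyP => i; rewrite coefD coefC coefMX coefC.
  have sz : (size (polyn z) <= 2)%N.
    rewrite -ltnS; apply: leq_trans (size_mk_monic z) _.
    by rewrite mk_monic_function_field size_function_field_poly.
  case: i => [|[|i]] /=; rewrite ?addr0 ?add0r //.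
  exact/nth_default/(leq_trans sz).
- by move=> a b ab0; apply: linear_poly_eq0; rewrite -valD ab0.
Qed.

End FunctionField.

Lemma isomorphic_cross_ratio (F : closedFieldType) (rs hs : seq F) x z :
    (2%:R : F) != 0 -> uniq rs -> uniq hs -> odd (size rs) -> (5 <= size hs)%N ->
    isomorphic (split_curve rs) (split_curve hs) ->
    0 \in rs -> x \in rs -> z \in rs -> z != 0 ->
  exists2 c, c \in cross_ratios hs & x = z * c.
Proof.
move=> nz2 urs uhs ors shs [phi [psi phiK psiK] phiC].
have surj w : exists v, phi v = w := ex_intro _ (psi w) (psiK w).
have inj w : phi w = 0 -> w = 0.
  by move=> w0; apply: (can_inj phiK); rewrite w0 rmorph0; reflexivity.
pose E1 : comNzRingType := {poly %/ function_field_poly (split_curve rs)}.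
pose E2 : comNzRingType := {poly %/ function_field_poly (split_curve hs)}.
pose phi' : {rmorphism E1 -> E2} := phi.
exact: (@iso_cross_ratio F rs hs E1 E2 _ _ _ _ (function_field_quadratic rs)
  (function_field_quadratic hs) phi' phiC surj inj).
Qed.

(** * Smoothness and good reduction *)

Section ChartInfinity.
Variable F : fieldType.
Implicit Types (p : {poly F}) (rs : seq F).

(** Reversal turns X - a into 1 - a X. The extra factor X comes from reversing a polynomial of
    degree 2g + 1 in degree 2g + 2. *)
Definition split_curve_infty rs : weierstrass F :=
  Weierstrass 0 ('X * \prod_(a <- rs) (1 - a *: 'X)).

Let rev d p := \poly_(i < d.+1) p`_(d - i).

Let rev_mulXsubC d p a : (size p <= d.+1)%N ->
  rev d.+1 (p * ('X - a%:P)) = rev d p * (1 - a *: 'X).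
Proof.
move=> sp; apply/polyP => i.
rewrite coef_poly [p * _]mulrBr coefB coefMX coefMC.
rewrite [_ * (1 - _)]mulrBr mulr1 -scalerAr coefB coefZ coefMX !coef_poly.
case: i => [|i]; rewrite ?subn0 /= ?mulr0 ?subr0.
  by rewrite (nth_default 0 sp) mul0r subr0.
rewrite subSS !ltnS; have [lid|ldi] := leqP i d; last first.
  by rewrite ltnNge ltnW ?mulr0 ?subr0.
have [->|nid] := eqVneq i d; first by rewrite subnn ltnn /= mulrC.
have lid' : (i < d)%N by rewrite ltn_neqAle nid.
by rewrite lid' subn_eq0 leqNgt lid' /= subnS mulrC.
Qed.

Let rev_prod rs :
  rev (size rs) (\prod_(a <- rs) ('X - a%:P)) = \prod_(a <- rs) (1 - a *: 'X).
Proof.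
elim: rs => [|a rs IH] /=.
  by rewrite !big_nil; apply/polyP => -[|i]; rewrite coef_poly !coef1.
rewrite !big_cons [('X - _) * _]mulrC rev_mulXsubC ?size_prod_XsubC //.
by rewrite IH mulrC.
Qed.

Let revS d p : (size p <= d.+1)%N -> rev d.+1 p = 'X * rev d p.
Proof.
move=> sp; apply/polyP => -[|i]; rewrite mulrC coefMX !coef_poly /=.
  by rewrite nth_default.
by rewrite ltnS subSS.
Qed.

Lemma chart_infty_split g rs : size rs = (2 * g).+1 ->
  chart_infty g (split_curve rs) = split_curve_infty rs.
Proof.
move=> srs; congr Weierstrass.
  by apply/polyP => i; rewrite coef_poly !coef0; case: ifP.
have := revS (p := \prod_(a <- rs) ('X - a%:P)) (d := size rs).
by rewrite rev_prod size_prod_XsubC leqnn srs; apply.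
Qed.

End ChartInfinity.

Lemma map_split_curve_infty (F F' : fieldType) (f : {rmorphism F -> F'}) rs :
  map_weierstrass f (split_curve_infty rs) = split_curve_infty (map f rs).
Proof.
rewrite /map_weierstrass /split_curve_infty /= rmorph0; congr Weierstrass.
rewrite rmorphM rmorph_prod big_map /= map_polyX; congr (_ * _).
apply: eq_bigr => a _.
by rewrite rmorphB rmorph1 /= map_polyZ map_polyX.
Qed.

Lemma root_split_infty (F : fieldType) (rs : seq F) z :
  root ('X * \prod_(a <- rs) (1 - a *: 'X)) z ->
  z = 0 \/ exists2 a, a \in rs & a * z = 1.
Proof.
rewrite rootM rootX => /orP[/eqP|]; first by left.
rewrite /root horner_prod prodf_seq_eq0 => /hasP[a ars].
by rewrite /= !hornerE subr_eq0 => /eqP e; right; exists a.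
Qed.

Section Smoothness.
Variable k : closedFieldType.
Hypothesis nz2 : (2%:R : k) != 0.

(** A singular point has 2y = 0, hence y = 0, and its abscissa is a double root of [P]. *)
Lemma smooth_chart_simple (P : {poly k}) :
  (forall x, root P x -> P^`().[x] != 0) -> smooth_chart (Weierstrass 0 P).
Proof.
move=> simple x y; rewrite /on_curve /singular_at /= horner0 mul0r !addr0.
move=> eP [/eqP]; rewrite -mulr_natr mulf_eq0 (negPf nz2) orbF => /eqP y0.
rewrite y0 mulr0 => eP'.
have Px : root P x by rewrite /root -eP y0 expr0n.
by have := simple x Px; rewrite -eP' eqxx.
Qed.

Let deriv_factor (p q : {poly k}) x : p.[x] = 0 ->
  (p * q)^`().[x] = p^`().[x] * q.[x].
Proof. by move=> px; rewrite derivM !hornerE px mul0r addr0. Qed.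

Lemma smooth_split g (rs : seq k) :
  uniq rs -> size rs = (2 * g).+1 -> smooth g (split_curve rs).
Proof.
move=> urs srs; split.
  apply: smooth_chart_simple => x; rewrite root_prod_XsubC => xrs.
  rewrite (big_rem x) //= deriv_factor ?hornerXsubC ?subrr //.
  rewrite derivXsubC hornerC mul1r horner_prod prodf_seq_neq0.
  apply/allP => b; rewrite mem_rem_uniq // inE => /andP[bx _].
  by rewrite /= hornerXsubC subr_eq0 eq_sym.
rewrite chart_infty_split //; apply: smooth_chart_simple => z /root_split_infty.
case=> [->|[a ars az]].
  rewrite deriv_factor ?hornerX // derivX hornerC mul1r horner_prod.
  by rewrite prodf_seq_neq0; apply/allP => b _; rewrite /= !hornerE ?mulr0 ?subr0 oner_eq0.
have z0 : z != 0 by apply: contra_eq_neq az => ->; rewrite mulr0 eq_sym oner_eq0.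
have a0 : a != 0 by apply: contra_eq_neq az => ->; rewrite mul0r eq_sym oner_eq0.
rewrite (big_rem a) //= mulrCA deriv_factor; last by rewrite !hornerE az subrr.
rewrite derivB derivZ derivX -polyC1 derivC sub0r !hornerE ?mulr1 ?mulf_neq0 ?oppr_eq0 //.
rewrite horner_prod prodf_seq_neq0; apply/allP => b.
(* Since a z = 1, the factor 1 - b z equals (a - b) z. *)
rewrite mem_rem_uniq // inE => /andP[bx _]; rewrite /= !hornerE -az -mulrBl.
by rewrite mulf_neq0 // subr_eq0 eq_sym.
Qed.

End Smoothness.

Lemma split_curve_bounded (F : fieldType) g (rs : seq F) :
  size rs = (2 * g).+1 -> weierstrass_bounded g (split_curve rs).
Proof.
by move=> srs; split; rewrite /= ?size_poly0 // size_prod_XsubC srs.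
Qed.

Lemma split_curve_hyperelliptic (F : fieldType) g (rs : seq F) :
    (2%:R : F) != 0 -> uniq rs -> size rs = (2 * g).+1 ->
  hyperelliptic g (split_curve rs).
Proof.
move=> nz2 urs srs; split; first exact: split_curve_bounded.
move=> k f; rewrite map_split_curve; apply: smooth_split.
- by rewrite -(rmorph_nat f) fmorph_eq0.
- by rewrite map_inj_uniq //; apply: fmorph_inj.
- by rewrite size_map.
Qed.

Lemma split_curve_rational (K : fieldExtType rat) g (rs : seq K) :
  size rs = (2 * g).+1 -> rational_weierstrass g (split_curve rs).
Proof.
have fixed (y : algC) : y = - y - 0 -> y = 0.
  move/eqP; rewrite subr0 -addr_eq0 -mulr2n -mulr_natr mulf_eq0 pnatr_eq0 orbF.
  by move/eqP.
move=> srs; split=> iota x y; rewrite ?chart_infty_split //.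
  rewrite map_split_curve => -[/= + ]; rewrite horner0 => + /fixed y0.
  rewrite /on_curve /= y0 mulr0 expr0n addr0 => /esym/rootP.
  rewrite root_prod_XsubC => /mapP[x0 _ ->].
  by exists x0, 0; rewrite rmorph0.
rewrite map_split_curve_infty => -[/= + ]; rewrite horner0 => + /fixed y0.
rewrite /on_curve /= y0 mulr0 expr0n addr0 => /esym/rootP/root_split_infty.
case=> [->|[a /mapP[a0 _ ->] e]]; first by exists 0, 0; rewrite rmorph0.
exists a0^-1, 0; rewrite rmorph0 fmorphV; split=> //.
have ia0 : iota a0 != 0.
  by apply: contra_eq_neq e => ->; rewrite mul0r eq_sym oner_eq0.
by apply: (mulfI ia0); rewrite e divff.
Qed.

Lemma isomorphic_refl (F : fieldType) (C : weierstrass F) : isomorphic C C.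
Proof. by exists idfun => //; exists idfun. Qed.

Section GoodReduction.
Variables (L : fieldType) (P : set L).
Hypothesis pP : is_prime P.

Lemma integers_local_ring x : integers x -> local_ring P x.
Proof.
move=> ix; exists x, 1; split=> //; first exact: integers_nat 1%N.
  exact: prime_proper.
by rewrite divr1.
Qed.

Lemma local_max_integers x : integers x -> local_max P x -> P x.
Proof.
move=> ix [a [b [Pa ib nPb e]]].
have b0 : b != 0 by apply/eqP => b0; apply: nPb; rewrite b0; apply: prime0.
by have /(prime_mul pP ix ib)[] : P (x * b) by rewrite e divfK.
Qed.

Lemma coef_prod_integers (rs : seq L) i : {in rs, forall a, integers a} ->
  integers (\prod_(a <- rs) ('X - a%:P))`_i.
Proof.
elim: rs i => [|a rs IH] i irs.
  by rewrite big_nil coef1; apply: integers_nat.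
have irs' j : integers (\prod_(a <- rs) ('X - a%:P))`_j.
  by apply: IH => b brs; apply: irs; rewrite inE brs orbT.
rewrite big_cons mulrBl coefB coefXM coefCM; apply: integersB.
  by case: (i == 0%N) => //; apply: integers_nat 0%N.
by apply: integersM => //; apply: irs; rewrite mem_head.
Qed.

Section Reduction.
Variables (k : closedFieldType) (rho : L -> k).
Hypothesis rhoP : reduction P rho.

Let rhoM x y : integers x -> integers y -> rho (x * y) = rho x * rho y.
Proof. by move=> ix iy; apply: (reductionM rhoP); apply: integers_local_ring. Qed.

Let rhoB x y : integers x -> integers y -> rho (x - y) = rho x - rho y.
Proof.
move=> ix iy; have := reductionD rhoP (integers_local_ring (integersB ix iy))
  (integers_local_ring iy).
by rewrite subrK => ->; rewrite addrK.
Qed.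

Let rho0 : rho 0 = 0.
Proof.
by rewrite -(subrr (1 : L)) rhoB ?subrr //; apply: integers_nat 1%N.
Qed.

Let rho_neq0 x : integers x -> ~ P x -> rho x != 0.
Proof.
move=> ix nPx; apply/eqP => /(reduction_eq0 rhoP (integers_local_ring ix)).
by move/(local_max_integers ix).
Qed.

(** [rho] is additive and multiplicative only on the local ring, so the product is mapped factor by
    factor, with integral coefficients throughout. *)
Lemma map_split_reduction rs : {in rs, forall a, integers a} ->
  map_weierstrass rho (split_curve rs) = split_curve (map rho rs).
Proof.
rewrite /map_weierstrass /split_curve /= map_poly0 => irs; congr Weierstrass.
elim: rs irs => [|a rs IH] irs.
  rewrite !big_nil; apply/polyP => i; rewrite coef_map_id0 // !coef1.
  by case: (i == 0%N); rewrite ?(reduction1 rhoP).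
have irs' : {in rs, forall a, integers a}.
  by move=> b brs; apply: irs; rewrite inE brs orbT.
have ia : integers a by apply: irs; rewrite mem_head.
rewrite /= !big_cons -IH //; apply/polyP => i.
rewrite coef_map_id0 // !mulrBl !coefB !coefXM !coefCM coef_map_id0 //.
rewrite rhoB; last 2 first.
- by case: (i == 0%N); [apply: integers_nat 0%N | apply: coef_prod_integers].
- by apply: integersM => //; apply: coef_prod_integers.
rewrite rhoM //; last exact: coef_prod_integers.
by case: (i == 0%N); rewrite ?rho0 ?coef_map_id0.
Qed.

Lemma smooth_reduction g rs : {in rs, forall a, integers a} -> uniq rs ->
    {in rs &, forall a b, a != b -> ~ P (a - b)} -> ~ P 2%:R ->
    size rs = (2 * g).+1 ->
  smooth g (map_weierstrass rho (split_curve rs)).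
Proof.
move=> irs urs nP nP2 srs; rewrite map_split_reduction //; apply: smooth_split.
- have -> : 2%:R = rho 2%:R.
    rewrite [in RHS]mulr2n (reductionD rhoP) ?(reduction1 rhoP) //;
    by apply: integers_local_ring; apply: integers_nat 1%N.
  by apply: rho_neq0 => //; apply: integers_nat.
- rewrite map_inj_in_uniq // => a b ars brs e; apply/eqP/contraT => ab.
  have := rho_neq0 (integersB (irs a ars) (irs b brs)) (nP a b ars brs ab).
  by rewrite rhoB ?e ?subrr ?eqxx //; apply: irs.
- by rewrite size_map.
Qed.

End Reduction.

Lemma split_curve_good_reduction g rs : {in rs, forall a, integers a} ->
    uniq rs -> {in rs &, forall a b, a != b -> ~ P (a - b)} -> ~ P 2%:R ->
    size rs = (2 * g).+1 ->
  good_reduction g P (split_curve rs).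
Proof.
move=> irs urs nP nP2 srs; exists (split_curve rs); split.
- exact: isomorphic_refl.
- exact: split_curve_bounded.
- move=> i; split; apply: integers_local_ring; last exact: coef_prod_integers.
  by rewrite coef0; apply: integers_nat 0%N.
- by move=> k rho rhoP; apply: smooth_reduction.
Qed.

End GoodReduction.

Lemma integers_rmorph (K L : fieldType) (f : {rmorphism K -> L}) x :
  integers x -> integers (f x).
Proof.
move=> [p mp px]; exists p => //.
have -> : map_poly intr p = map_poly f (map_poly intr p).
  by rewrite -map_poly_comp; apply: eq_map_poly => m /=; rewrite rmorph_int.
exact: rmorph_root.
Qed.

Lemma split_curve_potentially_good (K : fieldExtType rat) g (p : set K) rs :
    {in rs, forall a, integers a} -> uniq rs ->
    {in rs &, forall a b, a != b -> ~ p (a - b)} -> ~ p 2%:R ->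
    size rs = (2 * g).+1 ->
  potentially_good_reduction g p (split_curve rs).
Proof.
(* The reduction is good without extending the field: [K^o] is [K] over itself. *)
move=> irs urs nP nP2 srs; exists K^o => P pP Pp.
rewrite map_split_curve; apply: split_curve_good_reduction => //.
- by move=> _ /mapP[a ars ->]; apply: integers_rmorph; apply: irs.
- by rewrite map_inj_uniq //; apply: fmorph_inj.
- move=> _ _ /mapP[a ars ->] /mapP[b brs ->].
  rewrite (inj_eq (fmorph_inj _)) -rmorphB => ab /Pp; exact: nP.
- by rewrite -(rmorph_nat (in_alg K^o)) => /Pp.
- by rewrite size_map.
Qed.

(** * The family of curves *)

(** Send a primitive element [z] to a root [w] in [algC] of its minimal polynomial. Some embedding
    is needed for [geom_isomorphic] to be reflexive. *)
Lemma numfield_embedding (K : fieldExtType rat) :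
  exists iota : {rmorphism K -> algC}, True.
Proof.
have sepK : separable 1%AS {:K}.
  apply/separableP => y _; apply: pcharf0_separable => p.
  by rewrite pchar_lalg pchar_num.
have ez := eq_adjoin_separable_generator sepK (sub1v _).
set z := separable_generator 1%AS {:K} in ez.
have qP y : exists q : {poly rat}, (map_poly (in_alg K) q).[z] = y.
  have /Fadjoin1_polyP[q ->] : y \in <<1; z>>%VS by rewrite -ez memvf.
  by exists q.
have [q qz] := choice qP.
have /polyOver1P[m em] := minPolyOver 1%AS z.
have sm : size (map_poly (ratr : rat -> algC) m) != 1%N.
  by rewrite size_map_poly -(size_map_poly (in_alg K)) -em size_minPoly.
have [w mw] := closed_rootP _ sm.
have kerP (p : {poly rat}) : (map_poly (in_alg K) p).[z] = 0 ->
    (map_poly (ratr : rat -> algC) p).[w] = 0.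
  move=> pz; have /dvdpP[r ->] : m %| p.
    rewrite -(dvdp_map (in_alg K)) -em; apply: minPoly_dvdp; last exact/rootP.
    exact: alg_polyOver.
  by rewrite rmorphM hornerM (rootP mw) mulr0.
pose f y : algC := (map_poly (ratr : rat -> algC) (q y)).[w].
(* The value does not depend on the polynomial chosen to represent [y]; this makes [f] a
   morphism. *)
have fE y (p : {poly rat}) : (map_poly (in_alg K) p).[z] = y ->
    f y = (map_poly (ratr : rat -> algC) p).[w].
  move=> py; apply/eqP; rewrite -subr_eq0 /f -hornerN -hornerD -rmorphB.
  by apply/eqP/kerP; rewrite rmorphB hornerD hornerN qz py subrr.
have fZ : zmod_morphism f.
  move=> a b; rewrite (fE _ (q a - q b)) ?rmorphB ?hornerD ?hornerN ?qz //.
have fM : monoid_morphism f.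
  split=> [|a b]; first by rewrite (fE _ 1) ?rmorph1 ?hornerC.
  by rewrite (fE _ (q a * q b)) ?rmorphM ?hornerM ?qz.
pose Z := GRing.isZmodMorphism.Build K algC f fZ.
pose M := GRing.isMonoidMorphism.Build K algC f fM.
pose iota : {rmorphism K -> algC} := HB.pack f Z M.
by exists iota.
Qed.

(** Brings the comparison of cross-ratios from [algC] back to [K]. *)
Lemma mem_cross_ratios_map (F F' : fieldType) (f : {rmorphism F -> F'}) hs c :
  c \in cross_ratios (map f hs) -> exists2 d, d \in cross_ratios hs & c = f d.
Proof.
pose fp (p : F * F) := (f p.1, f p.2).
have pts : branch_points (map f hs) = map fp (branch_points hs).
  rewrite /branch_points /= /fp rmorph1 rmorph0; congr cons.
  by rewrite -!map_comp; apply: eq_map => a /=; rewrite rmorph1.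
have det p q : pt_det (fp p) (fp q) = f (pt_det p q).
  by rewrite /pt_det rmorphB !rmorphM.
rewrite /cross_ratios pts; move: (branch_points hs) => {pts} pts.
case/allpairsP => -[pq0 rs0] /= [].
case/allpairsP => -[p0 q0] /= [/mapP[p ph ->] /mapP[q qh ->] ->].
case/allpairsP => -[r0 s0] /= [/mapP[r rh ->] /mapP[s sh ->] ->] ->.
exists (cross_ratio (p, q) (r, s)); first by do 3!apply: allpairs_f => //.
by rewrite /cross_ratio /= !det fmorph_div !rmorphM.
Qed.

Section Construction.
Variables (K : fieldExtType rat) (g : nat).
Hypothesis hg : (2 <= g)%N.

Let N : K := (2 * g)`!%:R.

Definition shifts : seq int := [seq i%:Z - (g.-1)%:Z | i <- iota 0 (2 * g - 1)].

Lemma mem_shifts (d : int) : (d \in shifts) = (`|d|%N < g)%N.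
Proof.
apply/mapP/idP => [[i]|dg]; first by rewrite mem_iota; lia.
exists (absz (d + (g.-1)%:Z)); first by rewrite mem_iota; lia.
by lia.
Qed.

Lemma shifts_uniq : uniq shifts.
Proof. by rewrite map_inj_uniq ?iota_uniq // => i j; lia. Qed.

Lemma size_shifts : size shifts = (2 * g - 1)%N.
Proof. by rewrite size_map size_iota. Qed.

Definition branch (x : K) : seq K :=
  x :: - x :: [seq d%:~R * N | d <- shifts].

Lemma size_branch x : size (branch x) = (2 * g).+1.
Proof. by rewrite /= size_map size_shifts; lia. Qed.

Lemma branch_mem0 x : 0 \in branch x.
Proof.
rewrite !inE; apply/or3P/Or33/mapP; exists 0; last by rewrite mul0r.
by rewrite mem_shifts; lia.
Qed.

Lemma branch_memN x : N \in branch x.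
Proof.
rewrite !inE; apply/or3P/Or33/mapP; exists 1; last by rewrite mul1r.
by rewrite mem_shifts; lia.
Qed.

Let N0 : N != 0.
Proof. by rewrite numfield_natr_eq0 -lt0n fact_gt0. Qed.

Let intr_eq0 (d : int) : (d%:~R == 0 :> K) = (d == 0).
Proof. by rewrite -(rmorph_int (in_alg K)) fmorph_eq0 intr_eq0. Qed.

Let intr_inj : injective (fun d : int => d%:~R * N).
Proof.
move=> c d /(mulIf N0)/eqP; rewrite -subr_eq0 -rmorphB intr_eq0 subr_eq0.
by move/eqP.
Qed.

Let integersN0 : integers N. Proof. exact: integers_nat. Qed.

Lemma shift_integers d : integers (d%:~R * N).
Proof. by apply: integersM => //; apply: integers_int. Qed.

Lemma branch_integers x : integers x -> {in branch x, forall a, integers a}.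
Proof.
move=> ix a; rewrite !inE => /or3P[/eqP->|/eqP->|/mapP[d _ ->]] //.
  exact: integersN.
exact: shift_integers.
Qed.

(** The shifts are symmetric about 0, so the hypothesis also controls x - dN. *)
Lemma branch_uniq x : (forall d, d \in shifts -> x + d%:~R * N != 0) ->
  uniq (branch x).
Proof.
move=> nz; have neg d : d \in shifts -> x != d%:~R * N.
  move=> dg; have: - d \in shifts by move: dg; rewrite !mem_shifts; lia.
  by move/nz; rewrite rmorphN mulNr subr_eq0.
have x0 : x != 0 by have := nz 0; rewrite mem_shifts mul0r addr0; apply; lia.
rewrite /= inE negb_or map_inj_uniq // shifts_uniq andbT -andbA; apply/and3P; split.
- rewrite -addr_eq0 -mulr2n -mulr_natr mulf_neq0 // numfield_natr_eq0 //.
- by apply/mapP => -[d /neg/eqP]; apply.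
- apply/mapP => -[d dg e]; have /eqP := nz d dg; apply.
  by rewrite -e subrr.
Qed.

(** Such a [d] divides (2g)!, which is [N]. *)
Lemma int_notin_prime (p : set K) (d : int) : is_prime p -> ~ p N ->
  d != 0 -> (`|d| <= 2 * g)%N -> ~ p d%:~R.
Proof.
move=> pp nN d0 dg pd; apply: nN.
have pabs : p `|d|%N%:R.
  case: d d0 dg pd => d // _ _ pd.
  by rewrite NegzE mulrNz in pd; rewrite -[_%:R]opprK; apply: primeN.
have /dvdnP[k ek] : (`|d| %| (2 * g)`!)%N.
  by apply: dvdn_fact; rewrite absz_gt0 d0.
by rewrite /N ek natrM; apply: (prime_mull pp) => //; apply: integers_nat.
Qed.

Lemma shift_diff_notin_prime (p : set K) c d : is_prime p -> ~ p N ->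
  c \in shifts -> d \in shifts -> c != d -> ~ p (c%:~R * N - d%:~R * N).
Proof.
move=> pp nN cg dg cd; rewrite -mulrBl -rmorphB.
move/(prime_mul pp (integers_int _ _) integersN0) => [|//].
apply: int_notin_prime => //; first by rewrite subr_eq0.
by move: cg dg; rewrite !mem_shifts; lia.
Qed.

Lemma branch_diff_notin_prime (p : set K) x : is_prime p -> integers x -> ~ p N ->
    (forall d, d \in shifts -> ~ p (x + d%:~R * N)) ->
  {in branch x &, forall a b, a != b -> ~ p (a - b)}.
Proof.
move=> pp ix nN nx.
have nx' d : d \in shifts -> ~ p (x - d%:~R * N).
  move=> dg; have: - d \in shifts by move: dg; rewrite !mem_shifts; lia.
  by move/nx; rewrite rmorphN mulNr.
have n2 : ~ p (x + x).
  rewrite -mulr2n -mulr_natl => /(prime_mul pp (integers_nat _ _) ix)[].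
    by apply: (@int_notin_prime p 2) => //; lia.
  by have := nx 0; rewrite mem_shifts mul0r addr0; apply; lia.
have opp a : p (- a) -> p a by move=> /(primeN pp); rewrite opprK.
move=> a b; rewrite !inE => /or3P[/eqP->|/eqP->|/mapP[c cg ->]]
  /or3P[/eqP->|/eqP->|/mapP[d dg ->]]; rewrite ?eqxx // ?opprK => ab pab.
- exact: n2.
- exact: nx' dg pab.
- by apply: n2; apply: opp; rewrite opprD.
- by apply: (nx d dg); apply: opp; rewrite opprD.
- by apply: (nx' c cg); apply: opp; rewrite opprB.
- by apply: (nx c cg); rewrite addrC.
- by apply: (shift_diff_notin_prime pp nN cg dg) pab; apply: contraNneq ab => ->.
Qed.

Let hl_tuple := in_tuple [seq d%:~R * N | d <- shifts].

Lemma shifts_admissible : admissible hl_tuple.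
Proof.
split.
- by rewrite map_inj_uniq ?shifts_uniq.
- by move=> i; have /mapP[d _ ->] := mem_tnth i hl_tuple; apply: shift_integers.
move=> p pp; have [pN|nN] := EM (p N).
  (* Here all entries of the tuple are 0 modulo [p], so the residue of 1 is missed. *)
  exists 1; first exact: integers_nat 1%N.
  move=> i; have /mapP[d _ ->] := mem_tnth i hl_tuple => p1.
  apply: (prime_proper pp); rewrite -[1](subKr (d%:~R * N)); apply: primeB => //.
  by apply: prime_mulz.
(* The 2g integers 0, ..., 2g - 1 are distinct modulo p. *)
apply: contrapT => nex.
have cover (j : 'I_(2 * g)) : exists i, p (tnth hl_tuple i - j%:R).
  apply: contrapT => ni; apply: nex; exists j%:R; first exact: integers_nat.
  by move=> i pi; apply: ni; exists i.
have [f fP] := choice cover.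
have inj : injective f.
  move=> j j' e; apply/val_inj/eqP/contraT => jj'; exfalso.
  have := primeB pp (fP j') (fP j); rewrite e opprB addrC addrA subrK.
  have -> : (j%:R - j'%:R : K) = (j%:Z - j'%:Z)%:~R by rewrite rmorphB.
  apply: int_notin_prime => //; first by rewrite subr_eq0 eqz_nat.
  by move: (ltn_ord j) (ltn_ord j'); lia.
have := leq_card f inj; rewrite !card_ord size_map size_shifts.
by lia.
Qed.

Section Curve.
Variable x : K.
Hypotheses (ix : integers x)
  (px : forall d, d \in shifts -> prime_element (x + d%:~R * N)).

Lemma curve_branch_uniq : uniq (branch x).
Proof.
apply: branch_uniq => d /px[_ pd]; apply/eqP => e.
by have [_ [a _ <-]] := prime_neq0 pd; rewrite e mulr0 eqxx.
Qed.

Lemma curve_hyperelliptic : hyperelliptic g (split_curve (branch x)).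
Proof.
apply: split_curve_hyperelliptic; rewrite ?size_branch ?curve_branch_uniq //.
by rewrite numfield_natr_eq0.
Qed.

Lemma curve_good : exists2 m,
  (m <= 2 * g - 1 + \dim (fullv : {vspace K}) * prime_pi (2 * g))%N &
  good_curve g m (split_curve (branch x)).
Proof.
have [s ss sP] := primes_fact_cover K (2 * g).
(* The primes containing (2g)! lie above the rational primes up to 2g, which gives the term with
   [prime_pi]; the 2g - 1 shifts give the others. *)
pose S := [set p : set K | is_prime p /\
  (p N \/ exists2 d, d \in shifts & p = principal (x + d%:~R * N))]%classic.
have [|m sm Sm] := @card_covered _ S
  ([seq principal (x + d%:~R * N) | d <- shifts] ++ s).
  move=> p [pp [pN|[d dg ep]]]; rewrite mem_cat; first by rewrite sP ?orbT.
  by apply/orP; left; apply/mapP; exists d.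
exists m.
  by apply: leq_trans sm _; rewrite size_cat size_map size_shifts leq_add2l.
split; first exact: curve_hyperelliptic.
  by apply: split_curve_rational; rewrite size_branch.
exists S; split=> [p []//|//|p pp nSp].
have nN : ~ p N by move=> pN; apply: nSp; split=> //; left.
apply: split_curve_potentially_good; rewrite ?size_branch ?curve_branch_uniq //.
- exact: branch_integers.
(* A prime containing x + dN contains the prime ideal it generates, hence equals it. *)
- apply: branch_diff_notin_prime => // d dg pd; apply: nSp; split=> //; right.
  exists d => //; have [_ qp] := px dg.
  have sub : (principal (x + d%:~R * N) `<=` p)%classic.
    by move=> _ [a ia <-]; apply: (prime_mull pp).
  by apply/seteqP; split=> //; apply: prime_incomparable.
- by apply: (@int_notin_prime p 2) => //; lia.
Qed.

End Curve.

Lemma class_cross_ratio x y : uniq (branch x) -> uniq (branch y) ->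
    hyperelliptic g (split_curve (branch y)) ->
    geom_class g (split_curve (branch x)) = geom_class g (split_curve (branch y)) ->
  x \in [seq N * c | c <- cross_ratios (branch y)].
Proof.
move=> ux uy hy e; have [iota0 _] := numfield_embedding K.
(* The curve of [y] lies in its own class, so the equality of classes yields an isomorphism from the
   curve of [x] to it. *)
have: geom_class g (split_curve (branch y)) (split_curve (branch y)).
  by split; [exact: hy | exists iota0; exact: isomorphic_refl].
rewrite -e => -[_ [iota]]; rewrite !map_split_curve => iso.
have inj := fmorph_inj iota.
have [|||||||||] := isomorphic_cross_ratio (x := iota x) (z := iota N) _ _ _ _ _ iso.
- by rewrite pnatr_eq0.
- by rewrite map_inj_uniq.
- by rewrite map_inj_uniq.
- by rewrite size_map size_branch /= oddM.
- by rewrite size_map size_branch; clear -hg; lia.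
- rewrite -(rmorph0 iota); exact: map_f (branch_mem0 x).
- exact: map_f (mem_head _ _).
- exact: map_f (branch_memN x).
- by rewrite fmorph_eq0.
move=> c /mem_cross_ratios_map[d dc ->]; rewrite -rmorphM => /inj ->.
exact: map_f.
Qed.

(** The number of bad primes depends on [x] but is bounded by [M]. If each [m] up to [M] gave
    finitely many classes, these finitely many classes, each with finitely many [x], would exhaust
    the infinite set [X]. *)
Lemma infinitely_many_good_exists : hardy_littlewood K -> exists2 m,
  (m <= 2 * g - 1 + \dim (fullv : {vspace K}) * prime_pi (2 * g))%N &
  infinitely_many_good K g m.
Proof.
move=> HL; set M := (_ + _)%N; apply: contrapT => nex.
pose X := [set x : K | integers x /\
  forall i, prime_element (x + tnth hl_tuple i)]%classic.
have Xpx x : X x -> forall d, d \in shifts -> prime_element (x + d%:~R * N).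
  move=> [_ px] d dg.
  have /tnthP[i ->] : d%:~R * N \in hl_tuple by apply: map_f.
  exact: px.
apply: (HL _ hl_tuple shifts_admissible); rewrite -/X.
pose cls x := geom_class g (split_curve (branch x)).
have fin_classes : finite_set (cls @` X)%classic.
  apply: (@sub_finite_set _ _ (\bigcup_(m in `I_M.+1)
      (geom_class g @` good_curve (K := K) g m))%classic).
    move=> _ [x Xx <-]; have [m mM gm] := curve_good Xx.1 (Xpx x Xx).
    by exists m; [rewrite /= ltnS | exists (split_curve (branch x))].
  apply: bigcup_finite => // m /=; rewrite ltnS => mM.
  by apply: contrapT => inf; apply: nex; exists m.
have: finite_set (\bigcup_(c in (cls @` X)) [set x | X x /\ cls x = c])%classic.
  apply: bigcup_finite => // _ [y Xy <-].
  apply: (sub_finite_set _ (finite_seq [seq N * c | c <- cross_ratios (branch y)])).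
  move=> x [Xx e]; apply: class_cross_ratio e.
  - exact: curve_branch_uniq (Xpx x Xx).
  - exact: curve_branch_uniq (Xpx y Xy).
  - exact: curve_hyperelliptic (Xpx y Xy).
by apply: sub_finite_set => x Xx; exists (cls x) => //; exists x.
Qed.

End Construction.

Theorem theorem14 (K : fieldExtType rat) (n g : nat)
  (hn : \dim (fullv : {vspace K}) = n) (hg : (2 <= g)%N)
  (HL : hardy_littlewood K) :
  exists2 c : nat, is_cK K g c & (c <= 2 * g - 1 + n * prime_pi (2 * g))%N.
Proof.
have [m mM im] := infinitely_many_good_exists hg HL.
have ex : exists c, `[< infinitely_many_good K g c >] by exists m; apply/asboolP.
case: (ex_minnP ex) => c /asboolP ic minc; exists c.
  by split=> // k ik; apply: minc; apply/asboolP.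
by apply: leq_trans (minc m _) _; [apply/asboolP | rewrite -hn].
Qed.
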